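(* Let $D=\{z\in\mathbb{C}:|z|<1\}$ and let $f(z)=\sum_{n=0}^{\infty} z^{2^n}=z+z^2+z^4+\cdots$ for $z\in D$. Then for every open disk $U\subset\mathbb{C}$ centered at $1$ and every complex number $v$, the function $f$ attains the value $v$ infinitely many times on $D\cap U$, i.e. there are infinitely many points $z\in D\cap U$ with $f(z)=v$.
   Context: The function $f$ (called the Fredholm series) is holomorphic on the open unit disk $D$, where its defining power series converges. *)

(* Defs.v *)
From Stdlib Require Import Reals Lra Lia Ensembles Finite_sets.
From Coquelicot Require Import Coquelicot.

Open Scope C_scope.

Definition unit_disk : Ensemble C := fun z => (Cmod z < 1)%R.

(* Stated with [Cmod] because Coquelicot's [ball] on [C] is that of the product
   uniform space [R * R], hence an open square rather than a round disk. *)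
Definition open_disk (c : C) (r : R) : Ensemble C :=
  fun z => (Cmod (z - c) < r)%R.

(* Meaningful for [z] in [unit_disk] (see [fredholm_correct]); elsewhere the
   series diverges and [iota] returns an unspecified value. *)
Definition fredholm (z : C) : C :=
  iota (T := C_CompleteNormedModule)
    (fun l : C => is_series (K := C_AbsRing) (V := C_NormedModule)
                    (fun n : nat => z ^ (2 ^ n)) l).

Lemma fredholm_correct (z : C) :
  unit_disk z ->
  is_series (K := C_AbsRing) (V := C_NormedModule)
    (fun n : nat => z ^ (2 ^ n)) (fredholm z).
Proof.
intros Hz; unfold unit_disk in Hz.
assert (H0 := Cmod_ge_0 z).
assert (Hex : ex_series (K := C_AbsRing) (V := C_CompleteNormedModule)
                (fun n : nat => z ^ (2 ^ n))).
{ apply (ex_series_le (K := C_AbsRing) (V := C_CompleteNormedModule) _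
           (fun n : nat => (Cmod z ^ n)%R)).
  - intros n; change (Cmod (z ^ (2 ^ n)) <= Cmod z ^ n)%R.
    rewrite Cmod_pow.
    assert (Hn : (n < 2 ^ n)%nat) by (apply Nat.pow_gt_lin_r; lia).
    replace (2 ^ n)%nat with (n + (2 ^ n - n))%nat by lia.
    rewrite pow_add.
    rewrite <- (Rmult_1_r (Cmod z ^ n)) at 2.
    apply Rmult_le_compat_l; [now apply pow_le|].
    rewrite <- (pow1 (2 ^ n - n)); apply pow_incr; lra.
  - apply ex_series_geom; rewrite Rabs_pos_eq; lra. }
destruct Hex as [l Hl].
apply (iota_correct (K := C_AbsRing) (V := C_CompleteNormedModule)
         (fun l : C => is_series (K := C_AbsRing) (V := C_NormedModule)
                         (fun n : nat => z ^ (2 ^ n)) l)).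
exists l; split; [exact Hl|].
intros l' Hl'.
exact (filterlim_locally_unique (K := C_AbsRing) (V := C_NormedModule)
         (F := eventually) _ l l' Hl Hl').
Qed.

(* Main.v *)
(** The series satisfies [f z = z + f (z ^ 2)].  Along the points
    [z_J = exp (- x / 2 ^ J) * cis (2 * PI * m / 2 ^ J)], which tend to [1] and
    satisfy [z_(J+1) ^ 2 = z_J], this gives
      [Re (f z_J) = J + Fsum x + Rsum m + small],  [Im (f z_J) = Ysum m + small],
    where [Fsum x = f (exp (- x))] and [Ysum a], [Rsum a] are the sums over [k] of
    [sin (PI a / 2 ^ k)] and [cos (PI a / 2 ^ k) - 1].

    Steering: [Ysum] and [Rsum] are almost additive under concatenation of binary
    expansions.  As [Ysum (1 + 2 ^ M) - 2 * Ysum 1] is nonzero and tends to [0], the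
    values of [Ysum] at integers are dense; inserting long blocks [0101...01]
    makes [Rsum m] as negative as desired compared with the bit length of [m], which
    leaves room to choose [J] large.  Moving [x] then makes the real part exact
    (intermediate values), with an arbitrarily small error on the imaginary part.

    Openness: if [zeta ^ (2 ^ K) = 1] and [t0 = exp (- s / 2 ^ K)] with
    [1/32 <= s <= 1/8], then [t |-> f (zeta t)] is, on the disk of radius
    [kap / 2 ^ K] about [t0], so close to an affine map of slope at least [4 * 2 ^ K]
    that Newton's iteration solves [f (zeta t) = v] whenever [v] is within [2 * kap]
    of [f (zeta t0)], with [kap] independent of [K] and [zeta].  This removes the
    remaining error. *)

Require Import Defs.
From Stdlib Require Import Reals Ensembles Finite_sets ZArith Lra Lia.
From Coquelicot Require Import Coquelicot.

Open Scope R_scope.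

(** * Dyadic sums *)

Lemma ex_series_half (c : R) : ex_series (fun k => c / 2 ^ k).
Proof.
apply (ex_series_ext (fun k => scal c ((/ 2) ^ k))).
- intros k; unfold scal; simpl; unfold mult; simpl.
  now rewrite pow_inv.
- apply (ex_series_scal (K := R_AbsRing) (V := R_NormedModule)),
    ex_series_geom; rewrite Rabs_pos_eq; lra.
Qed.

Lemma Series_half (c : R) : Series (fun k => c / 2 ^ k) = 2 * c.
Proof.
rewrite (Series_ext _ (fun k => c * (/ 2) ^ k)).
- rewrite Series_scal_l, Series_geom; [field | rewrite Rabs_pos_eq; lra].
- intros k; now rewrite pow_inv.
Qed.

Lemma Series_abs_le (u b : nat -> R) :
  (forall k, Rabs (u k) <= b k) -> ex_series b -> Rabs (Series u) <= Series b.
Proof.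
intros H Hb.
assert (Hu : ex_series (fun k => Rabs (u k))).
{ apply (ex_series_le (K := R_AbsRing) (V := R_CompleteNormedModule) _ b); auto.
  intros k; change (Rabs (Rabs (u k)) <= b k); now rewrite Rabs_Rabsolu. }
apply Rle_trans with (1 := Series_Rabs _ Hu).
apply Series_le; auto; intros k; split; auto using Rabs_pos.
Qed.

Lemma Rabs_sin_le (x : R) : Rabs (sin x) <= Rabs x.
Proof.
destruct (Rtotal_order x 0) as [H|[H|H]].
- assert (H1 := sin_gt_x x H); assert (H2 := SIN_bound x).
  rewrite (Rabs_left x H); apply Rabs_le; split; [lra|].
  destruct (Rle_dec x (-1)); [lra|].
  assert (sin x <= 0); [|lra].
  assert (0 <= sin (-x)); [|rewrite sin_neg in *; lra].
  apply sin_ge_0; [lra | assert (H3 := PI2_1); lra].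
- subst; rewrite sin_0, Rabs_R0; lra.
- assert (H1 := sin_lt_x x H); assert (H2 := SIN_bound x).
  rewrite (Rabs_pos_eq x) by lra; apply Rabs_le; split; [|lra].
  destruct (Rle_dec 1 x); [lra|].
  assert (0 <= sin x); [|lra].
  apply sin_ge_0; [lra | assert (H3 := PI2_1); lra].
Qed.

Lemma Rabs_mult3_le (a b x y : R) :
  Rabs a <= 1 -> Rabs b <= 1 -> Rabs x <= y -> Rabs (2 * a * b * x) <= 2 * y.
Proof.
intros Ha Hb Hx; rewrite !Rabs_mult, (Rabs_pos_eq 2) by lra.
assert (0 <= Rabs a) by apply Rabs_pos; assert (0 <= Rabs b) by apply Rabs_pos.
assert (0 <= Rabs x) by apply Rabs_pos.
assert (Rabs a * Rabs b <= 1) by nra.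
nra.
Qed.

Lemma Rabs_sin_le_1 (x : R) : Rabs (sin x) <= 1.
Proof. apply Rabs_le, SIN_bound. Qed.

Lemma Rabs_cos_le_1 (x : R) : Rabs (cos x) <= 1.
Proof. apply Rabs_le, COS_bound. Qed.

Lemma Rabs_cos_minus_cos (x y : R) : Rabs (cos x - cos y) <= Rabs (x - y).
Proof.
rewrite form2.
replace (-2 * _ * _) with (2 * 1 * sin ((x + y) / 2) * - sin ((x - y) / 2)) by ring.
replace (Rabs (x - y)) with (2 * Rabs ((x - y) / 2)).
- apply Rabs_mult3_le.
  + rewrite Rabs_R1; lra.
  + apply Rabs_sin_le_1.
  + rewrite Rabs_Ropp; apply Rabs_sin_le.
- rewrite <- (Rabs_pos_eq 2) at 1 by lra; rewrite <- Rabs_mult; f_equal; field.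
Qed.

Lemma Rabs_sin_minus_sin (x y : R) : Rabs (sin x - sin y) <= Rabs (x - y).
Proof.
rewrite <- (cos_shift x), <- (cos_shift y), Rabs_minus_sym.
replace (x - y) with ((PI / 2 - y) - (PI / 2 - x)) by ring.
apply Rabs_cos_minus_cos.
Qed.

(** Abstracts [sin] and [cos - 1], so that imaginary and real parts are handled together; 1 is
    subtracted because the terms must vanish as the angle tends to 0. The second bound involves [x]
    alone, so [y] may be huge: this lets a small number be attached to a large one at low cost. *)
Definition angular (h : R -> R) : Prop :=
  (forall x, Rabs (h x) <= Rabs x) /\
  (forall x y, Rabs (h (x + y) - h x - h y) <= 2 * Rabs x) /\
  (forall x (k : Z), h (x + 2 * IZR k * PI) = h x).

Lemma sin_period_Z (x : R) (k : Z) : sin (x + 2 * IZR k * PI) = sin x.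
Proof.
destruct (Z.le_gt_cases 0 k) as [Hk|Hk].
- rewrite <- (Z2Nat.id k Hk), <- INR_IZR_INZ; apply sin_period.
- set (n := Z.to_nat (- k)).
  assert (Hn : IZR k = - INR n).
  { unfold n; rewrite INR_IZR_INZ, Z2Nat.id, opp_IZR by lia; ring. }
  rewrite <- (sin_period (x + _) n), Hn; f_equal; ring.
Qed.

Lemma cos_period_Z (x : R) (k : Z) : cos (x + 2 * IZR k * PI) = cos x.
Proof.
rewrite !cos_sin, <- (sin_period_Z (PI / 2 + x) k); f_equal; ring.
Qed.

Lemma angular_sin : angular sin.
Proof.
split; [|split].
- apply Rabs_sin_le.
- intros x y.
  replace (sin (x + y) - sin x - sin y) with ((sin (x + y) - sin y) + - sin x) by ring.
  apply Rle_trans with (1 := Rabs_triang _ _); rewrite Rabs_Ropp.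
  assert (H := Rabs_sin_le x); assert (H' := Rabs_sin_minus_sin (x + y) y).
  replace (x + y - y) with x in H' by ring; lra.
- apply sin_period_Z.
Qed.

Lemma angular_cos : angular (fun x => cos x - 1).
Proof.
split; [|split].
- intros x; rewrite <- cos_0.
  assert (H := Rabs_cos_minus_cos x 0); now rewrite Rminus_0_r in H.
- intros x y.
  replace (_ - _ - _) with ((cos (x + y) - cos y) + - (cos x - cos 0))
    by (rewrite cos_0; ring).
  apply Rle_trans with (1 := Rabs_triang _ _); rewrite Rabs_Ropp.
  assert (H := Rabs_cos_minus_cos x 0); assert (H' := Rabs_cos_minus_cos (x + y) y).
  replace (x + y - y) with x in H' by ring; rewrite Rminus_0_r in H; lra.
- intros x k; now rewrite cos_period_Z.
Qed.

Definition dsum (h : R -> R) (a : R) : R := Series (fun k => h (PI * a / 2 ^ k)).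

Lemma two_pow_pos (k : nat) : 0 < 2 ^ k.
Proof. apply pow_lt; lra. Qed.

Lemma Rabs_angle (a : R) (k : nat) : Rabs (PI * a / 2 ^ k) = PI * Rabs a / 2 ^ k.
Proof.
assert (H := PI_RGT_0).
rewrite Rabs_div by (apply Rgt_not_eq, two_pow_pos).
now rewrite Rabs_mult, (Rabs_pos_eq PI), (Rabs_pos_eq (2 ^ k))
  by (left; auto using two_pow_pos).
Qed.

Lemma ex_dsum (h : R -> R) (a : R) :
  angular h -> ex_series (fun k => h (PI * a / 2 ^ k)).
Proof.
intros [H1 _].
apply (ex_series_le (K := R_AbsRing) (V := R_CompleteNormedModule) _
         (fun k => PI * Rabs a / 2 ^ k)); [|apply ex_series_half].
intros k; apply Rle_trans with (1 := H1 _); rewrite Rabs_angle; lra.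
Qed.

Lemma dsum_bound (h : R -> R) (a : R) :
  angular h -> Rabs (dsum h a) <= 2 * PI * Rabs a.
Proof.
intros [H1 _]; unfold dsum.
rewrite Rmult_assoc, <- Series_half.
apply Series_abs_le; [|apply ex_series_half].
intros k; apply Rle_trans with (1 := H1 _); rewrite Rabs_angle; lra.
Qed.

Lemma dsum_step (h : R -> R) (a : R) :
  angular h -> dsum h a = h (PI * a) + dsum h (a / 2).
Proof.
intros Hh; unfold dsum; rewrite Series_incr_1 by now apply ex_dsum.
f_equal.
- f_equal; simpl; field.
- apply Series_ext; intros k; f_equal; simpl; field.
  apply Rgt_not_eq, two_pow_pos.
Qed.

Lemma dsum_quasi_additive (h : R -> R) (a b : R) :
  angular h -> Rabs (dsum h (a + b) - dsum h a - dsum h b) <= 4 * PI * Rabs a.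
Proof.
intros Hh; destruct (Hh) as (_ & H2 & _); unfold dsum.
rewrite <- Series_minus by now apply ex_dsum.
rewrite <- Series_minus; try (now apply ex_dsum).
- replace (4 * PI * Rabs a) with (2 * (2 * PI * Rabs a)) by ring.
  rewrite <- Series_half; apply Series_abs_le; [|apply ex_series_half].
  intros k.
  replace (PI * (a + b) / 2 ^ k) with (PI * a / 2 ^ k + PI * b / 2 ^ k)
    by (unfold Rdiv; ring).
  apply Rle_trans with (1 := H2 _ _); rewrite Rabs_angle.
  apply Req_le; unfold Rdiv; ring.
- apply (ex_series_minus (V := R_NormedModule)); now apply ex_dsum.
Qed.

(** Each of the first [M] terms has angles differing by a multiple of 2 PI on the two sides, so
    these terms cancel in the difference; the induction strips them one at a time with
    [dsum_step]. *)
Lemma dsum_shift (h : R -> R) (b : R) (n : Z) (M : nat) :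
  angular h ->
  dsum h (b + 2 ^ M * IZR n) - dsum h b
  = dsum h (b / 2 ^ M + IZR n) - dsum h (b / 2 ^ M).
Proof.
intros Hh; destruct (Hh) as (_ & _ & H3); revert b.
induction M as [|M IH]; intros b.
- simpl; replace (b / 1) with b by field; now rewrite Rmult_1_l.
- replace (b / 2 ^ S M) with (b / 2 / 2 ^ M)
    by (simpl; field; apply Rgt_not_eq, two_pow_pos).
  rewrite <- IH, (dsum_step h (b + _)), (dsum_step h b) by exact Hh.
  replace (PI * (b + 2 ^ S M * IZR n)) with (PI * b + 2 * IZR (2 ^ Z.of_nat M * n) * PI).
  + rewrite H3.
    replace ((b + 2 ^ S M * IZR n) / 2) with (b / 2 + 2 ^ M * IZR n) by (simpl; field).
    ring.
  + rewrite mult_IZR, <- pow_IZR; simpl; ring.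
Qed.

(** When [m] is small against [2 ^ M], this is concatenation of binary expansions, [m] supplying the
    low digits. [dsum_shift] replaces [m] by [m / 2 ^ M], and quasi-additivity then costs an error
    proportional to that small number, whatever [n] is. *)
Lemma dsum_concat (h : R -> R) (m n : Z) (M : nat) :
  angular h ->
  Rabs (dsum h (IZR (m + 2 ^ Z.of_nat M * n)) - dsum h (IZR m) - dsum h (IZR n))
  <= 4 * PI * Rabs (IZR m) / 2 ^ M.
Proof.
intros Hh.
rewrite plus_IZR, mult_IZR, <- pow_IZR, dsum_shift by exact Hh.
apply Rle_trans with (1 := dsum_quasi_additive h _ _ Hh).
rewrite Rabs_div by (apply Rgt_not_eq, two_pow_pos).
rewrite (Rabs_pos_eq (2 ^ M)) by (left; apply two_pow_pos).
apply Req_le; unfold Rdiv; ring.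
Qed.

Lemma dsum_odd (h : R -> R) (a : R) :
  (forall x, h (- x) = - h x) -> dsum h (- a) = - dsum h a.
Proof.
intros H; unfold dsum; rewrite <- Series_opp; apply Series_ext; intros k.
rewrite <- H; f_equal; unfold Rdiv; ring.
Qed.

Lemma dsum_even (h : R -> R) (a : R) :
  (forall x, h (- x) = h x) -> dsum h (- a) = dsum h a.
Proof.
intros H; unfold dsum; apply Series_ext; intros k.
rewrite <- H; f_equal; unfold Rdiv; ring.
Qed.

Notation Ysum := (dsum sin).
Notation Rsum := (dsum (fun x => cos x - 1)).

Lemma Ysum_opp (a : R) : Ysum (- a) = - Ysum a.
Proof. apply dsum_odd, sin_neg. Qed.

Lemma Rsum_opp (a : R) : Rsum (- a) = Rsum a.
Proof. apply (dsum_even (fun x => cos x - 1)); intros x; now rewrite cos_neg. Qed.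

Lemma Series_le_0 (u : nat -> R) :
  (forall k, u k <= 0) -> ex_series u -> Series u <= 0.
Proof.
intros H Hu.
assert (H0 : Series (fun k : nat => 0 * 0) = 0) by (rewrite Series_scal_l; ring).
assert (H1 : Series (fun k : nat => 0 * 0) <= Series (fun k => - u k)).
{ apply Series_le; [intros k; specialize (H k); lra|].
  now apply (ex_series_opp (V := R_NormedModule)). }
rewrite Series_opp in H1; lra.
Qed.

Lemma Rsum_le_0 (a : R) : Rsum a <= 0.
Proof.
apply Series_le_0; [|apply (ex_dsum (fun x => cos x - 1)), angular_cos].
intros k; assert (H := COS_bound (PI * a / 2 ^ k)); lra.
Qed.

Lemma sin_subadditive (a b : R) :
  0 <= a -> 0 <= b -> a + b <= PI -> sin (a + b) - sin a - sin b <= 0.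
Proof.
intros Ha Hb Hab; rewrite sin_plus.
assert (0 <= sin a) by (apply sin_ge_0; lra).
assert (0 <= sin b) by (apply sin_ge_0; lra).
assert (H1 := COS_bound a); assert (H2 := COS_bound b); nra.
Qed.

(** The term of index 0 contributes [- 2 * sin (PI * a)], which is negative. In all later terms the
    two angles add up to at most PI, where sine is subadditive, so they contribute nothing
    positive. *)
Lemma Ysum_defect_neg (a : R) : 0 < a < 1 -> Ysum (a + 1) - Ysum a - Ysum 1 < 0.
Proof.
intros Ha.
assert (HP := PI_RGT_0).
rewrite (dsum_step sin (a + 1)), (dsum_step sin a), (dsum_step sin 1)
  by apply angular_sin.
rewrite Rmult_1_r, sin_PI.
replace (PI * (a + 1)) with (PI * a + PI) by ring; rewrite neg_sin.
assert (0 < sin (PI * a)) by (apply sin_gt_0; nra).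
assert (Ysum ((a + 1) / 2) - Ysum (a / 2) - Ysum (1 / 2) <= 0); [|lra].
unfold dsum.
rewrite <- Series_minus by (apply ex_dsum, angular_sin).
rewrite <- Series_minus; try (apply ex_dsum, angular_sin).
2: apply (ex_series_minus (V := R_NormedModule)); apply ex_dsum, angular_sin.
apply Series_le_0.
- intros k.
  replace (PI * ((a + 1) / 2) / 2 ^ k)
    with (PI * (a / 2) / 2 ^ k + PI * (1 / 2) / 2 ^ k)
    by (field; apply Rgt_not_eq, two_pow_pos).
  assert (Hk := two_pow_pos k).
  assert (Hk1 : 1 <= 2 ^ k) by (apply pow_R1_Rle; lra).
  assert (H0 : forall c, 0 <= c -> 0 <= c / 2 ^ k <= c).
  { intros c Hc; split; [now apply Rdiv_le_0_compat|].
    apply Rmult_le_reg_r with (2 ^ k); auto.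
    unfold Rdiv; rewrite Rmult_assoc, Rinv_l by lra; nra. }
  assert (H1 := H0 (PI * (a / 2)) ltac:(nra)).
  assert (H2 := H0 (PI * (1 / 2)) ltac:(nra)).
  assert (H3 := sin_subadditive (PI * (a / 2) / 2 ^ k) (PI * (1 / 2) / 2 ^ k)).
  enough (PI * (a / 2) + PI * (1 / 2) <= PI) by lra; nra.
- repeat apply (ex_series_minus (V := R_NormedModule)); apply ex_dsum, angular_sin.
Qed.

Lemma pow2_arch (A e : R) : 0 < e -> exists M : nat, A / 2 ^ M < e.
Proof.
intros He.
destruct (archimed (A / e)) as [H1 _].
exists (Z.to_nat (up (A / e))).
set (M := Z.to_nat _).
assert (HM : A / e < INR M).
{ destruct (Z.le_gt_cases 0 (up (A / e))) as [H|H].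
  - unfold M; rewrite INR_IZR_INZ, Z2Nat.id; auto.
  - apply Rlt_le_trans with (2 := pos_INR M).
    apply Rlt_trans with (1 := H1); now apply IZR_lt. }
assert (H2 : INR M < 2 ^ M).
{ clear; assert (H : (M < 2 ^ M)%nat) by (apply Nat.pow_gt_lin_r; lia).
  apply lt_INR in H; now rewrite pow_INR in H. }
assert (HP := two_pow_pos M).
apply Rmult_lt_reg_r with (2 ^ M); auto.
unfold Rdiv at 1; rewrite Rmult_assoc, Rinv_l, Rmult_1_r by lra.
replace A with (e * (A / e)) by (field; lra).
apply Rmult_lt_compat_l; lra.
Qed.

(** * Steering *)

Lemma cos_2PI3_pow2 (l : nat) : cos (2 * (PI / 3) * 2 ^ l) = -1 / 2.
Proof.
induction l as [|l IH].
- now rewrite pow_O, Rmult_1_r, cos_2PI3.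
- replace (2 * (PI / 3) * 2 ^ S l) with (2 * (2 * (PI / 3) * 2 ^ l)) by (simpl; ring).
  rewrite cos_2a_cos, IH; field.
Qed.

(** Halving preserves the form of the argument and halves [d]. Each term has an angle within
    [PI * d / 3] of one whose cosine is -1/2, so it is at most [- 3 / 2 + PI * d / 3]; the errors
    sum geometrically. *)
Lemma Rsum_third_le (l : nat) (d : R) :
  0 <= d -> Rsum ((2 ^ l - d) / 3) <= - (3 / 2) * INR l + 2 * PI / 3 * d.
Proof.
assert (HP := PI_RGT_0); revert d; induction l as [|l IH]; intros d Hd.
- assert (H := Rsum_le_0 ((2 ^ 0 - d) / 3)); simpl INR; nra.
- rewrite dsum_step by apply angular_cos.
  replace ((2 ^ S l - d) / 3 / 2) with ((2 ^ l - d / 2) / 3) by (simpl; field).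
  assert (H := IH (d / 2) ltac:(lra)).
  assert (H1 := Rabs_cos_minus_cos (PI * ((2 ^ S l - d) / 3)) (2 * (PI / 3) * 2 ^ l)).
  replace (PI * ((2 ^ S l - d) / 3) - 2 * (PI / 3) * 2 ^ l) with (- (PI * d / 3)) in H1
    by (simpl; field).
  rewrite Rabs_Ropp, (Rabs_pos_eq (PI * d / 3)), cos_2PI3_pow2 in H1 by nra.
  apply Rabs_le_between in H1; rewrite S_INR; lra.
Qed.

(* Binary expansion [0101...01] with [n] blocks: the doubling orbit of
   [third n / 4 ^ n] stays close to [{1/3, 2/3}], where the real part is [-1/2]. *)
Fixpoint third (n : nat) : Z :=
  match n with O => 0 | S n => 4 * third n + 1 end%Z.

Lemma third_eq (n : nat) : IZR (third n) = (2 ^ (2 * n) - 1) / 3.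
Proof.
induction n as [|n IH]; [simpl; field|].
replace (2 * S n)%nat with (S (S (2 * n))) by lia.
change (third (S n)) with (4 * third n + 1)%Z.
rewrite plus_IZR, mult_IZR, IH; simpl pow; field.
Qed.

(** The [2 * n] binary digits bring about -3/2 each, while lengthening the orbit by one step gains
    only 1. This surplus is what makes steering possible. *)
Lemma Rsum_third (n : nat) : Rsum (IZR (third n)) <= - 3 * INR n + 3.
Proof.
rewrite third_eq.
assert (H := Rsum_third_le (2 * n) 1 ltac:(lra)).
assert (H4 := PI_4); rewrite mult_INR in H; simpl (INR 2) in H; lra.
Qed.

Lemma INR_arch (x : R) : exists n : nat, x <= INR n.
Proof.
destruct (Rle_lt_dec x 0) as [H|H]; [now exists 0%nat|].
exists (Z.to_nat (up x)); destruct (archimed x) as [H1 _].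
assert (0 < up x)%Z by (apply lt_IZR; lra).
rewrite INR_IZR_INZ, Z2Nat.id by lia; lra.
Qed.

(* A point of angle [m / 2 ^ J] with [J >= B] is near [1]; the bound [N] makes
   the negative contributions of [m] outweigh the [B] units gained on the way. *)
Definition steerable (y : R) : Prop :=
  forall eps N : R, 0 < eps ->
  exists (m : Z) (B : nat),
    Rabs (IZR m) <= 2 ^ B /\ Rabs (Ysum (IZR m) - y) < eps /\
    INR B + Rsum (IZR m) <= N.

(** A block and its negative, placed far apart, cancel in the odd sum [Ysum] but reinforce each
    other in the even sum [Rsum]. *)
Lemma steerable_0 : steerable 0.
Proof.
intros eps N Heps.
(* [c] is the padding between the two blocks: it brings the concatenation error below [eps] for
   [Ysum] and below 1 for [Rsum]. *)
destruct (pow2_arch (4 * PI) (Rmin eps 1)) as [c Hc].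
{ apply Rmin_pos; lra. }
(* The bit length is [4 * n + c] and [Rsum] is at most [- 6 * n + 6 + 1], so the total is at most
   [- 2 * n + c + 7], which must not exceed [N]. *)
destruct (INR_arch ((INR c + 7 - N) / 2)) as [n Hn].
set (M := (2 * n + c)%nat).
exists (- third n + 2 ^ Z.of_nat M * third n)%Z, (M + 2 * n)%nat.
assert (HP := PI_RGT_0).
assert (HA := two_pow_pos (2 * n)); assert (HB := two_pow_pos c).
assert (H1 : 1 <= 2 ^ (2 * n)) by (apply pow_R1_Rle; lra).
assert (Ht := third_eq n).
assert (Herr : 4 * PI * Rabs (IZR (- third n)) / 2 ^ M <= 4 * PI / 2 ^ c).
{ rewrite opp_IZR, Rabs_Ropp, Rabs_pos_eq by lra.
  unfold M; rewrite pow_add.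
  apply Rmult_le_reg_r with (2 ^ (2 * n) * 2 ^ c); [nra|].
  replace (4 * PI * IZR (third n) / (2 ^ (2 * n) * 2 ^ c) * (2 ^ (2 * n) * 2 ^ c))
    with (4 * PI * IZR (third n)) by (field; lra).
  replace (4 * PI / 2 ^ c * (2 ^ (2 * n) * 2 ^ c)) with (4 * PI * 2 ^ (2 * n))
    by (field; lra).
  nra. }
assert (Hm1 := Rmin_l eps 1); assert (Hm2 := Rmin_r eps 1).
assert (HY := dsum_concat sin (- third n) (third n) M angular_sin).
assert (HR := dsum_concat _ (- third n) (third n) M angular_cos).
rewrite opp_IZR, Ysum_opp, <- opp_IZR in HY.
rewrite (opp_IZR (third n)), Rsum_opp, <- opp_IZR in HR.
split; [|split].
- rewrite plus_IZR, mult_IZR, <- pow_IZR, opp_IZR, pow_add.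
  change (IZR 2) with 2.
  assert (H2 : 1 <= 2 ^ M) by (apply pow_R1_Rle; lra).
  rewrite Rabs_pos_eq by nra; nra.
- replace (Ysum _ - 0)
    with (Ysum (IZR (- third n + 2 ^ Z.of_nat M * third n)) - - Ysum (IZR (third n))
          - Ysum (IZR (third n))) by ring.
  lra.
- apply Rabs_le_between in HR.
  assert (H3 := Rsum_third n).
  unfold M at 1; rewrite !plus_INR, mult_INR; simpl (INR 2); lra.
Qed.

(** Attach [m0] as low digits below a witness for [y]. The extra length is fixed before that witness
    is chosen, so it can be charged to [N] in advance; [Rsum] of [m0] is nonpositive and can only
    help. *)
Lemma steerable_add (y : R) (m0 : Z) : steerable y -> steerable (y + Ysum (IZR m0)).
Proof.
intros Hy eps N Heps.
destruct (pow2_arch (4 * PI * Rabs (IZR m0)) (Rmin (eps / 2) 1)) as [M HM].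
{ apply Rmin_pos; lra. }
assert (Hm1 := Rmin_l (eps / 2) 1); assert (Hm2 := Rmin_r (eps / 2) 1).
(* The 2 pays for the extra bit in [M + B + 1] and for the concatenation error in [Rsum], which is
   below 1. *)
destruct (Hy (eps / 2) (N - INR M - 2) ltac:(lra)) as (m & B & H1 & H2 & H3).
exists (m0 + 2 ^ Z.of_nat M * m)%Z, (M + B + 1)%nat.
assert (HY := dsum_concat sin m0 m M angular_sin).
assert (HR := dsum_concat _ m0 m M angular_cos).
assert (HA := two_pow_pos M); assert (HB : 1 <= 2 ^ B) by (apply pow_R1_Rle; lra).
assert (H0 := Rabs_pos (IZR m0)).
split; [|split].
- rewrite plus_IZR, mult_IZR, <- pow_IZR, !pow_add, pow_1.
  change (IZR 2) with 2.
  apply Rle_trans with (1 := Rabs_triang _ _).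
  rewrite Rabs_mult, (Rabs_pos_eq (2 ^ M)) by lra.
  assert (Rabs (IZR m0) <= 2 ^ M); [|nra].
  assert (HP := PI2_1).
  assert (HM' : 4 * PI * Rabs (IZR m0) < 2 ^ M); [|nra].
  replace (4 * PI * Rabs (IZR m0)) with (4 * PI * Rabs (IZR m0) / 2 ^ M * 2 ^ M)
    by (field; lra).
  nra.
- apply Rabs_le_between in HY; apply Rabs_lt_between in H2; apply Rabs_lt_between; lra.
- apply Rabs_le_between in HR.
  assert (HR0 := Rsum_le_0 (IZR m0)).
  rewrite !plus_INR; simpl (INR 1); lra.
Qed.

Lemma steerable_mult (d : R) (n : nat) :
  (forall y, steerable y -> steerable (y + d)) -> steerable (INR n * d).
Proof.
intros Hd; induction n as [|n IH].
- rewrite Rmult_0_l; apply steerable_0.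
- rewrite S_INR, Rmult_plus_distr_r, Rmult_1_l; auto.
Qed.

(** Translations by [d] and by [- d] preserve steerability, since [d] is a sum of values of [Ysum]
    at integers and [Ysum] is odd. As [d] is nonzero and small, its multiples approximate every real
    number. *)
Lemma steerable_all (y : R) : steerable y.
Proof.
intros eps N Heps.
destruct (pow2_arch (4 * PI) (eps / 2) ltac:(lra)) as [M0 HM0].
(* The successor ensures [1 / 2 ^ M < 1], as [Ysum_defect_neg] requires. *)
set (M := S M0).
assert (HA := two_pow_pos M0).
set (d := Ysum (IZR (1 + 2 ^ Z.of_nat M * 1)) - Ysum 1 - Ysum 1).
assert (Hd1 : Rabs d < eps / 2).
{ apply Rle_lt_trans with (1 := dsum_concat sin 1 1 M angular_sin).
  apply Rlt_trans with (2 := HM0).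
  rewrite Rabs_R1, Rmult_1_r; assert (HP := PI_RGT_0).
  apply Rmult_lt_compat_l; [lra|].
  apply Rinv_lt_contravar; simpl; nra. }
assert (Hd2 : d < 0).
{ unfold d; rewrite plus_IZR, mult_IZR, <- pow_IZR.
  assert (H := dsum_shift sin 1 1 M angular_sin).
  change (IZR 2) with 2; rewrite H.
  apply Ysum_defect_neg; simpl.
  assert (HA1 : 1 <= 2 ^ M0) by (apply pow_R1_Rle; lra).
  split; [apply Rdiv_lt_0_compat; lra|].
  apply Rmult_lt_reg_r with (2 * 2 ^ M0); [lra|]; field_simplify; lra. }
assert (Hneg : forall z, steerable z -> steerable (z + d)).
{ intros z Hz; unfold d.
  replace (z + _) with (z + Ysum (IZR (1 + 2 ^ Z.of_nat M * 1)) + Ysum (IZR (-1))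
                        + Ysum (IZR (-1))).
  - now do 3 apply steerable_add.
  - rewrite (Ysum_opp 1 : Ysum (IZR (-1)) = _); ring. }
assert (Hpos : forall z, steerable z -> steerable (z + - d)).
{ intros z Hz; unfold d.
  replace (z + _) with (z + Ysum (IZR (- (1 + 2 ^ Z.of_nat M * 1))) + Ysum 1 + Ysum 1).
  - now do 3 apply steerable_add.
  - rewrite (opp_IZR (1 + _)), Ysum_opp; ring. }
assert (Hnet : exists y0, steerable y0 /\ Rabs (y0 - y) < eps / 2).
{ set (q := up (y / - d)).
  destruct (archimed (y / - d)) as [Ha1 Ha2]; fold q in Ha1, Ha2.
  exists (IZR q * - d); split.
  - destruct (Z.le_gt_cases 0 q) as [Hq|Hq].
    + rewrite <- (Z2Nat.id q Hq), <- INR_IZR_INZ; now apply steerable_mult.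
    + replace (IZR q * - d) with (INR (Z.to_nat (- q)) * d).
      * now apply steerable_mult.
      * rewrite INR_IZR_INZ, Z2Nat.id, opp_IZR by lia; ring.
  - apply Rle_lt_trans with (2 := Hd1).
    rewrite (Rabs_left d) by exact Hd2.
    replace (IZR q * - d - y) with ((IZR q - y / - d) * - d) by (field; lra).
    rewrite Rabs_mult, (Rabs_pos_eq (- d)) by lra.
    rewrite Rabs_pos_eq by lra; nra. }
destruct Hnet as (y0 & Hy0 & Hlt).
destruct (Hy0 (eps / 2) N ltac:(lra)) as (m & B & H1 & H2 & H3).
exists m, B; split; [|split]; auto.
apply Rabs_lt_between in H2; apply Rabs_lt_between in Hlt; apply Rabs_lt_between; lra.
Qed.

(** * The series along square-root orbits *)

Lemma Cmod_series_le (u : nat -> C) (b : nat -> R) (l : C) :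
  is_series (K := C_AbsRing) (V := C_NormedModule) u l ->
  (forall k, Cmod (u k) <= b k) -> ex_series b -> Cmod l <= Series b.
Proof.
intros Hu Hb Hex.
apply Series_correct in Hex.
apply (is_lim_seq_le (fun n => Cmod (sum_n u n)) (sum_n b) (Cmod l) (Series b)).
- intros n; apply Rle_trans with (1 := norm_sum_n_m (V := C_NormedModule) u 0 n).
  now apply sum_n_m_le.
- apply (filterlim_comp _ _ _ (sum_n u) Cmod _ _ _ Hu).
  exact (filterlim_norm (K := C_AbsRing) (V := C_NormedModule) l).
- exact Hex.
Qed.

Lemma C_series_unique (u : nat -> C) (l l' : C) :
  is_series (K := C_AbsRing) (V := C_NormedModule) u l ->
  is_series (K := C_AbsRing) (V := C_NormedModule) u l' -> l = l'.
Proof.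
intros Hl Hl'.
exact (filterlim_locally_unique (K := C_AbsRing) (V := C_NormedModule)
         (F := eventually) _ l l' Hl Hl').
Qed.

Lemma fredholm_step (z : C) :
  Cmod z < 1 -> fredholm z = Cplus z (fredholm (Cmult z z)).
Proof.
intros Hz.
assert (H0 := Cmod_ge_0 z).
assert (Hzz : Cmod (z * z)%C < 1) by (rewrite Cmod_mult; nra).
apply (C_series_unique (fun n => Cpow z (2 ^ n))).
- now apply fredholm_correct.
- assert (H := fredholm_correct (z * z)%C Hzz).
  apply (is_series_decr_1 (K := C_AbsRing) (V := C_NormedModule)).
  match goal with |- is_series _ ?l => replace l with (fredholm (z * z)%C) end.
  + apply (is_series_ext (K := C_AbsRing) (V := C_NormedModule)) with (2 := H).
    intros n; rewrite Nat.pow_succ_r', Cpow_mult_r; f_equal.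
    simpl; ring.
  + change (fredholm (z * z) = (z + fredholm (z * z)) + - Cpow z (2 ^ 0))%C.
    simpl; ring.
Qed.

Lemma Cmod_fst_snd (x y : R) : Cmod (x, y) ^ 2 = x ^ 2 + y ^ 2.
Proof. exact (Cmod2_alt (x, y)). Qed.

Lemma is_series_RtoC (u : nat -> R) (l : R) :
  is_series u l ->
  is_series (K := C_AbsRing) (V := C_NormedModule) (fun n => RtoC (u n)) (RtoC l).
Proof.
intros Hu; unfold is_series in *.
apply (filterlim_ext (fun n => RtoC (sum_n u n))).
- intros n; induction n as [|n IH]; [now rewrite !sum_O|].
  rewrite !sum_Sn, <- IH; exact (RtoC_plus (sum_n u n) (u (S n))).
- apply (filterlim_comp _ _ _ (sum_n u) RtoC _ _ _ Hu).
  apply (filterlim_locally (U := C_UniformSpace) (F := locally l)); intros eps.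
  exists eps; intros y Hy; split; [exact Hy|].
  simpl; apply (ball_center (M := R_UniformSpace)).
Qed.

Definition Fsum (x : R) : R := Series (fun k => exp (- (x * 2 ^ k))).

Lemma exp_opp_le_inv (t : R) : 0 < t -> exp (- t) <= / t.
Proof.
intros Ht; rewrite exp_Ropp; apply Rinv_le_contravar; auto.
assert (H := exp_ineq1_le t); lra.
Qed.

Lemma exp_ge_1_minus (x : R) : 1 - x <= exp (- x).
Proof. assert (H := exp_ineq1_le (- x)); lra. Qed.

Lemma exp_opp_le_1 (x : R) : 0 <= x -> 0 < exp (- x) <= 1.
Proof.
intros Hx; split; [apply exp_pos|].
rewrite <- exp_0; destruct Hx as [Hx| <-]; [|rewrite Ropp_0; lra].
left; apply exp_increasing; lra.
Qed.

Lemma ex_Fsum (x : R) : 0 < x -> ex_series (fun k => exp (- (x * 2 ^ k))).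
Proof.
intros Hx.
apply (ex_series_le (K := R_AbsRing) (V := R_CompleteNormedModule) _
         (fun k => / x / 2 ^ k)); [|apply ex_series_half].
intros k; change (Rabs (exp (- (x * 2 ^ k))) <= / x / 2 ^ k).
assert (H := two_pow_pos k).
rewrite Rabs_pos_eq by (left; apply exp_pos).
apply Rle_trans with (1 := exp_opp_le_inv _ (Rmult_lt_0_compat _ _ Hx H)).
rewrite Rinv_mult; apply Rle_refl.
Qed.

Lemma Fsum_half (x : R) : 0 < x -> Fsum (x / 2) = exp (- (x / 2)) + Fsum x.
Proof.
intros Hx; unfold Fsum; rewrite Series_incr_1 by (apply ex_Fsum; lra).
f_equal; [f_equal; simpl; ring|].
apply Series_ext; intros k; f_equal; simpl; field.
Qed.

(** Two uses of the functional equation add two terms close to 1. The gain 3/2 will cover the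
    rounding of [J] to an integer plus an error 1/4 at each end of the interval. *)
Lemma Fsum_quarter (x : R) : 0 < x <= 1 / 8 -> Fsum x + 3 / 2 <= Fsum (x / 4).
Proof.
intros Hx; replace (x / 4) with (x / 2 / 2) by field.
rewrite !Fsum_half by lra.
assert (H1 := exp_ge_1_minus (x / 2)); assert (H2 := exp_ge_1_minus (x / 2 / 2)); lra.
Qed.

Lemma exp_lipschitz (a b c : R) :
  c <= a -> c <= b -> Rabs (exp (- a) - exp (- b)) <= Rabs (a - b) * exp (- c).
Proof.
assert (Hw : forall a b, c <= a -> a <= b ->
          Rabs (exp (- a) - exp (- b)) <= Rabs (a - b) * exp (- c)).
{ clear a b; intros a b Ha Hab.
  replace (exp (- b)) with (exp (- a) * exp (- (b - a))) by (rewrite <- exp_plus; f_equal; ring).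
  assert (H1 := exp_ge_1_minus (b - a)).
  assert (H2 := exp_opp_le_1 (b - a) ltac:(lra)).
  assert (H3 := exp_pos (- a)).
  assert (H4 : exp (- a) <= exp (- c)).
  { destruct (Rle_lt_or_eq_dec _ _ Ha) as [H| ->]; [left; apply exp_increasing|]; lra. }
  rewrite Rabs_pos_eq by nra; rewrite Rabs_left1 by lra; nra. }
intros Ha Hb; destruct (Rle_dec a b) as [H|H]; [now apply Hw|].
rewrite Rabs_minus_sym, (Rabs_minus_sym a); apply Hw; lra.
Qed.

(** Write [exp (- u)] as the power [S n] of [exp (- u / S n)] and apply [exp (- w) <= / w]: one
    factor [2 ^ k] survives in the denominator and gives a geometric majorant. *)
Lemma exp_pow_le (s : R) (n k : nat) :
  0 < s -> exp (- (s * 2 ^ k)) * (2 ^ k) ^ n <= (INR (S n) / s) ^ S n / 2 ^ k.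
Proof.
intros Hs.
assert (Hk := two_pow_pos k).
assert (HS : 0 < INR (S n)) by (apply lt_0_INR; lia).
assert (Hsk : s <> 0 /\ 2 ^ k <> 0 /\ INR (S n) <> 0) by lra.
replace (exp (- (s * 2 ^ k))) with (exp (- (s * 2 ^ k / INR (S n))) ^ S n).
- assert (H := exp_opp_le_inv (s * 2 ^ k / INR (S n)) ltac:(apply Rdiv_lt_0_compat; nra)).
  apply Rle_trans with ((/ (s * 2 ^ k / INR (S n))) ^ S n * (2 ^ k) ^ n).
  + apply Rmult_le_compat_r; [left; now apply pow_lt|].
    apply pow_incr; split; [left; apply exp_pos | exact H].
  + replace (/ (s * 2 ^ k / INR (S n))) with (INR (S n) / s * / 2 ^ k) by (field; tauto).
    rewrite Rpow_mult_distr, pow_inv.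
    apply Req_le; simpl (pow (2 ^ k) (S n)); field.
    split; [|apply pow_nonzero]; tauto.
- rewrite <- Rpower_pow by apply exp_pos; unfold Rpower; rewrite ln_exp.
  f_equal; field; tauto.
Qed.

Lemma ex_series_exp_pow (s : R) (n : nat) :
  0 < s -> ex_series (fun k => exp (- (s * 2 ^ k)) * (2 ^ k) ^ n).
Proof.
intros Hs.
apply (ex_series_le (K := R_AbsRing) (V := R_CompleteNormedModule) _
         (fun k => (INR (S n) / s) ^ S n / 2 ^ k)); [|apply ex_series_half].
intros k; change (Rabs (exp (- (s * 2 ^ k)) * (2 ^ k) ^ n)
                  <= (INR (S n) / s) ^ S n / 2 ^ k).
rewrite Rabs_pos_eq; [now apply exp_pow_le|].
left; apply Rmult_lt_0_compat; [apply exp_pos | apply pow_lt, two_pow_pos].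
Qed.

Lemma Fsum_lipschitz (c : R) :
  0 < c -> exists A, 0 <= A /\
  forall x y, c <= x -> c <= y -> Rabs (Fsum x - Fsum y) <= A * Rabs (x - y).
Proof.
intros Hc; exists (Series (fun k => exp (- (c * 2 ^ k)) * (2 ^ k) ^ 1)).
split.
{ apply Rle_trans with (1 := Rabs_pos (Series (fun k => 0))).
  apply Series_abs_le; [|now apply ex_series_exp_pow].
  intros k; rewrite Rabs_R0; left.
  apply Rmult_lt_0_compat; [apply exp_pos | apply pow_lt, two_pow_pos]. }
intros x y Hx Hy; unfold Fsum.
rewrite <- Series_minus by (apply ex_Fsum; lra).
rewrite <- Series_scal_r; apply Series_abs_le.
- intros k; assert (Hk := two_pow_pos k).
  apply Rle_trans with (1 := exp_lipschitz (x * 2 ^ k) (y * 2 ^ k) (c * 2 ^ k)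
                               ltac:(nra) ltac:(nra)).
  rewrite <- Rmult_minus_distr_r, Rabs_mult, (Rabs_pos_eq (2 ^ k)) by lra.
  rewrite pow_1; apply Req_le; ring.
- now apply ex_series_scal_r, ex_series_exp_pow.
Qed.

(** The complex exponential of [- x + i a], in logarithmic polar coordinates: products add both
    coordinates and powers scale them. *)
Definition pt (a x : R) : C := (exp (- x) * cos a, exp (- x) * sin a).

Lemma pt_mult (a b x y : R) : Cmult (pt a x) (pt b y) = pt (a + b) (x + y).
Proof.
unfold pt, Cmult; simpl.
replace (- (x + y)) with (- x + - y) by ring.
rewrite exp_plus, cos_plus, sin_plus; f_equal; ring.
Qed.

Lemma pt_pow (a x : R) (n : nat) : Cpow (pt a x) n = pt (INR n * a) (INR n * x).
Proof.
induction n as [|n IH].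
- unfold pt; simpl; rewrite !Rmult_0_l, Ropp_0, exp_0, cos_0, sin_0.
  unfold RtoC; f_equal; ring.
- rewrite Cpow_S, IH, pt_mult, S_INR; f_equal; ring.
Qed.

Lemma Cmod_pt (a x : R) : Cmod (pt a x) = exp (- x).
Proof.
assert (H := Cmod_fst_snd (exp (- x) * cos a) (exp (- x) * sin a)).
fold (pt a x) in H.
assert (H1 := sin2_cos2 a); unfold Rsqr in H1.
assert (H2 := Cmod_ge_0 (pt a x)); assert (H3 := exp_pos (- x)).
assert (H4 : Cmod (pt a x) * Cmod (pt a x) = exp (- x) * exp (- x)).
{ replace (exp (- x) * exp (- x))
    with ((sin a * sin a + cos a * cos a) * (exp (- x) * exp (- x)))
    by (rewrite H1; ring).
  simpl in H; lra. }
nra.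
Qed.

Lemma pt_2PI (m : Z) (x : R) : pt (2 * IZR m * PI) x = RtoC (exp (- x)).
Proof.
unfold pt; rewrite <- (Rplus_0_l (2 * IZR m * PI)).
rewrite cos_period_Z, sin_period_Z, cos_0, sin_0; unfold RtoC; f_equal; ring.
Qed.

Lemma fredholm_exp (x : R) : 0 < x -> fredholm (RtoC (exp (- x))) = RtoC (Fsum x).
Proof.
intros Hx.
apply (C_series_unique (fun n => Cpow (RtoC (exp (- x))) (2 ^ n))).
- apply fredholm_correct; unfold unit_disk.
  rewrite Cmod_R, Rabs_pos_eq by (left; apply exp_pos).
  rewrite <- exp_0; apply exp_increasing; lra.
- apply (is_series_ext (K := C_AbsRing) (V := C_NormedModule)
           (fun n => RtoC (exp (- (x * 2 ^ n))))).
  + intros n; rewrite <- (pt_2PI 0 x), pt_pow, <- (pt_2PI 0).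
    rewrite pow_INR; change (INR 2) with 2.
    f_equal; ring.
  + apply is_series_RtoC, Series_correct, ex_Fsum, Hx.
Qed.

Definition orbit_pt (m : Z) (x : R) (J : nat) : C :=
  pt (2 * PI * IZR m / 2 ^ J) (x / 2 ^ J).

Lemma orbit_pt_0 (m : Z) (x : R) : orbit_pt m x 0 = RtoC (exp (- x)).
Proof.
unfold orbit_pt; rewrite <- (pt_2PI m); f_equal; simpl; field.
Qed.

Lemma orbit_pt_sqr (m : Z) (x : R) (J : nat) :
  Cmult (orbit_pt m x (S J)) (orbit_pt m x (S J)) = orbit_pt m x J.
Proof.
unfold orbit_pt; rewrite pt_mult; assert (H := two_pow_pos J).
f_equal; simpl; field; lra.
Qed.

Lemma fredholm_orbit_pt (m : Z) (x : R) (J : nat) :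
  0 < x ->
  fredholm (orbit_pt m x (S J))
  = Cplus (orbit_pt m x (S J)) (fredholm (orbit_pt m x J)).
Proof.
intros Hx; rewrite fredholm_step, orbit_pt_sqr; auto.
unfold orbit_pt; rewrite Cmod_pt, <- exp_0; apply exp_increasing.
enough (0 < x / 2 ^ S J) by lra.
apply Rdiv_lt_0_compat; auto using two_pow_pos.
Qed.

Lemma orbit_pt_S (m : Z) (x : R) (J : nat) :
  orbit_pt m x (S J) = pt (PI * (IZR m / 2 ^ J)) (x / 2 ^ J / 2).
Proof.
assert (HJ := two_pow_pos J).
unfold orbit_pt; f_equal; simpl; field; lra.
Qed.

Lemma Rmult_exp_error (c x : R) :
  Rabs c <= 1 -> 0 <= x -> Rabs (exp (- x) * c - c) <= x.
Proof.
intros Hc Hx.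
replace (exp (- x) * c - c) with (- ((1 - exp (- x)) * c)) by ring.
rewrite Rabs_Ropp, Rabs_mult.
assert (H1 := exp_ge_1_minus x); assert (H2 := exp_opp_le_1 x Hx).
rewrite Rabs_pos_eq by lra.
assert (H3 := Rabs_pos c); nra.
Qed.

(** One step up the orbit adds [exp (- x / 2 ^ (J + 1)) * sin q] to the imaginary part, while the
    remaining [Ysum] loses exactly [sin q]. The mismatch is at most [x / 2 ^ (J + 1)], and these
    errors add up to [x - x / 2 ^ J]. The start is exact because [f] is real at [exp (- x)]. *)
Lemma Im_fredholm_orbit (m : Z) (x : R) (J : nat) :
  0 < x ->
  Rabs (Im (fredholm (orbit_pt m x J)) + Ysum (IZR m / 2 ^ J) - Ysum (IZR m))
  <= x - x / 2 ^ J.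
Proof.
intros Hx; induction J as [|J IH].
- rewrite orbit_pt_0, fredholm_exp by exact Hx; simpl.
  rewrite !Rdiv_1_r, Rplus_0_l, !Rminus_diag, Rabs_R0; lra.
- rewrite fredholm_orbit_pt by exact Hx.
  rewrite (dsum_step sin (IZR m / 2 ^ J)) in IH by apply angular_sin.
  assert (HJ := two_pow_pos J).
  replace (IZR m / 2 ^ S J) with (IZR m / 2 ^ J / 2) by (simpl; field; lra).
  rewrite orbit_pt_S; set (fx := fredholm (orbit_pt m x J)) in *.
  set (q := PI * (IZR m / 2 ^ J)) in *.
  assert (H : 0 < x / 2 ^ J) by now apply Rdiv_lt_0_compat.
  replace (x / 2 ^ S J) with (x / 2 ^ J / 2) by (simpl; field; lra).
  change (Im (Cplus (pt q (x / 2 ^ J / 2)) fx)) with (exp (- (x / 2 ^ J / 2)) * sin q + Im fx).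
  assert (H1 := Rmult_exp_error (sin q) (x / 2 ^ J / 2) (Rabs_sin_le_1 q) ltac:(lra)).
  apply Rabs_le_between in H1; apply Rabs_le_between in IH.
  apply Rabs_le_between; lra.
Qed.

(** Same telescoping, with [cos q] split as [1 + (cos q - 1)]: the ones accumulate to [J]. *)
Lemma Re_fredholm_orbit (m : Z) (x : R) (J : nat) :
  0 < x ->
  Rabs (Re (fredholm (orbit_pt m x J)) + Rsum (IZR m / 2 ^ J)
        - (INR J + Fsum x + Rsum (IZR m)))
  <= x - x / 2 ^ J.
Proof.
intros Hx; induction J as [|J IH].
- rewrite orbit_pt_0, fredholm_exp by exact Hx; simpl.
  rewrite !Rdiv_1_r.
  replace (_ - _) with 0 by ring; rewrite Rabs_R0; lra.
- rewrite fredholm_orbit_pt by exact Hx.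
  rewrite (dsum_step _ (IZR m / 2 ^ J)) in IH by apply angular_cos.
  assert (HJ := two_pow_pos J).
  replace (IZR m / 2 ^ S J) with (IZR m / 2 ^ J / 2) by (simpl; field; lra).
  rewrite orbit_pt_S; set (fx := fredholm (orbit_pt m x J)) in *.
  rewrite S_INR; set (q := PI * (IZR m / 2 ^ J)) in *.
  assert (H : 0 < x / 2 ^ J) by now apply Rdiv_lt_0_compat.
  replace (x / 2 ^ S J) with (x / 2 ^ J / 2) by (simpl; field; lra).
  change (Re (Cplus (pt q (x / 2 ^ J / 2)) fx)) with (exp (- (x / 2 ^ J / 2)) * cos q + Re fx).
  assert (H1 := Rmult_exp_error (cos q) (x / 2 ^ J / 2) (Rabs_cos_le_1 q) ltac:(lra)).
  apply Rabs_le_between in H1; apply Rabs_le_between in IH.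
  apply Rabs_le_between; lra.
Qed.

Lemma Re_fredholm_orbit_lipschitz (m : Z) (c : R) (J : nat) :
  0 < c -> exists A, 0 <= A /\
  forall x y, c <= x -> c <= y ->
  Rabs (Re (fredholm (orbit_pt m x J)) - Re (fredholm (orbit_pt m y J)))
  <= A * Rabs (x - y).
Proof.
intros Hc; induction J as [|J [A [HA IH]]].
- destruct (Fsum_lipschitz c Hc) as (A & HA & H); exists A; split; auto.
  intros x y Hx Hy; rewrite !orbit_pt_0, !fredholm_exp by lra; now apply H.
- exists (A + 1); split; [lra|]; intros x y Hx Hy.
  rewrite !fredholm_orbit_pt by lra; specialize (IH x y Hx Hy).
  set (fx := fredholm (orbit_pt m x J)) in *; set (fy := fredholm (orbit_pt m y J)) in *.
  rewrite !orbit_pt_S; set (q := PI * (IZR m / 2 ^ J)).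
  set (x' := x / 2 ^ J / 2); set (y' := y / 2 ^ J / 2).
  change (Rabs ((exp (- x') * cos q + Re fx) - (exp (- y') * cos q + Re fy))
          <= (A + 1) * Rabs (x - y)).
  replace (_ - _) with ((Re fx - Re fy) + (exp (- x') - exp (- y')) * cos q) by ring.
  apply Rle_trans with (1 := Rabs_triang _ _).
  rewrite Rmult_plus_distr_r; apply Rplus_le_compat; auto.
  assert (HJ : 1 <= 2 ^ J) by (apply pow_R1_Rle; lra).
  assert (HJ' : 0 < / 2 ^ J <= 1).
  { split; [apply Rinv_0_lt_compat; lra|].
    rewrite <- Rinv_1; apply Rinv_le_contravar; lra. }
  assert (H := exp_lipschitz x' y' 0 ltac:(unfold x', Rdiv; nra) ltac:(unfold y', Rdiv; nra)).
  rewrite Ropp_0, exp_0, Rmult_1_r in H.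
  replace (x' - y') with ((x - y) * (/ 2 ^ J / 2)) in H
    by (unfold x', y', Rdiv; ring).
  rewrite Rabs_mult, (Rabs_pos_eq (/ 2 ^ J / 2)) in H by lra.
  rewrite Rabs_mult.
  assert (H1 := Rabs_cos_le_1 q); assert (H2 := Rabs_pos (cos q)).
  assert (H4 := Rabs_pos (x - y)).
  set (e := Rabs (exp _ - exp _)) in *.
  assert (H3 : 0 <= e) by apply Rabs_pos.
  apply Rle_trans with (e * 1); nra.
Qed.

Lemma lipschitz_IVT (g : R -> R) (A a b y : R) :
  a <= b -> 0 <= A ->
  (forall x z, a <= x -> a <= z -> Rabs (g x - g z) <= A * Rabs (x - z)) ->
  g b <= y <= g a -> exists x, a <= x <= b /\ g x = y.
Proof.
intros Hab HA Hg Hy.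
(* [g] is controlled only to the right of [a]; freezing it below [a] gives a function continuous on
   the whole line. *)
assert (Hc : continuity (fun x => g (Rmax a x))).
{ intros x eps Heps; exists (eps / (A + 1)); split.
  { apply Rdiv_lt_0_compat; lra. }
  intros z [_ Hz]; simpl in *; unfold Rdist in *.
  apply Rle_lt_trans with (1 := Hg _ _ (Rmax_l _ _) (Rmax_l _ _)).
  assert (H : Rabs (Rmax a z - Rmax a x) <= Rabs (z - x)).
  { unfold Rmax, Rabs; repeat destruct Rle_dec; repeat destruct Rcase_abs; lra. }
  apply Rmult_lt_compat_r with (r := A + 1) in Hz; [|lra].
  unfold Rdiv in Hz; rewrite Rmult_assoc, Rinv_l in Hz by lra.
  assert (H1 := Rabs_pos (z - x)).
  set (p := Rabs (Rmax a z - Rmax a x)) in *; set (q := Rabs (z - x)) in *.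
  assert (0 <= p) by apply Rabs_pos; nra. }
destruct (IVT_gen _ a b y Hc) as (x & Hx & Hgx).
- rewrite (Rmax_left a a), (Rmax_right a b) by lra.
  rewrite Rmin_right, Rmax_left by lra; exact Hy.
- rewrite Rmin_left, Rmax_right in Hx by lra.
  rewrite Rmax_right in Hgx by lra; eauto.
Qed.

(** * Uniform openness near the circle *)

Lemma Cmod_le_by_eps (x : C) (b : R) :
  (forall eps, 0 < eps -> Cmod x <= b * eps) -> x = RtoC 0.
Proof.
intros H; apply Cmod_eq_0, Rle_antisym; [|apply Cmod_ge_0].
destruct (Rle_dec b 0) as [Hb|Hb].
- assert (H1 := H 1 ltac:(lra)); lra.
- apply le_epsilon; intros eps He.
  assert (H1 := H (eps / b) ltac:(apply Rdiv_lt_0_compat; lra)).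
  replace (b * (eps / b)) with eps in H1 by (field; lra); lra.
Qed.

Fixpoint newton (phi : C -> C) (t0 v : C) (a : R) (n : nat) : C :=
  match n with
  | O => t0
  | S n => let t := newton phi t0 v a n in (t + (v - phi t) / RtoC a)%C
  end.

(** The derivative is frozen at [a]. Since [phi] minus the linear map of slope [a] is
    [a / 2]-Lipschitz, each step halves the bound on the residual; the increments [d n] are at most
    [rho / 2 / 2 ^ n], so the iterates stay in the disk and converge. *)
Lemma newton_solution (phi : C -> C) (t0 v : C) (a rho : R) :
  0 < a -> 0 < rho ->
  (forall t t', Cmod (t - t0)%C <= rho -> Cmod (t' - t0)%C <= rho ->
     Cmod (phi t - phi t' - RtoC a * (t - t'))%C <= a / 2 * Cmod (t - t')%C) ->
  Cmod (v - phi t0)%C <= a / 2 * rho ->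
  exists t, Cmod (t - t0)%C <= rho /\ phi t = v.
Proof.
intros Ha Hr Hphi Hv.
set (T := newton phi t0 v a).
set (d := fun n => ((v - phi (T n)) / RtoC a)%C).
assert (Ha0 : RtoC a <> RtoC 0) by (intros E; injection E; lra).
assert (HT : forall n, T (S n) = (T n + d n)%C) by reflexivity.
assert (Hd : forall n, Cmod (d n) = Cmod (v - phi (T n))%C / a).
{ intros n; unfold d; rewrite Cmod_div, Cmod_R, Rabs_pos_eq by (auto; lra); auto. }
assert (Hinv : forall n, Cmod (T n - t0)%C <= rho - rho / 2 ^ n /\
                         Cmod (d n) <= rho / 2 / 2 ^ n).
{ assert (Hd0 : forall n e, Cmod (v - phi (T n))%C <= a * e -> Cmod (d n) <= e).
  { intros n e H; rewrite Hd; apply Rmult_le_reg_r with a; auto.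
    unfold Rdiv; rewrite Rmult_assoc, Rinv_l; lra. }
  induction n as [|n [IH1 IH2]].
  - split.
    + change (T 0%nat) with t0; replace (t0 - t0)%C with (RtoC 0) by ring.
      rewrite Cmod_0; simpl; lra.
    + apply Hd0; change (T 0%nat) with t0; simpl; lra.
  - assert (Hp := two_pow_pos n).
    assert (E : rho / 2 ^ S n = rho / 2 / 2 ^ n) by (simpl; field; lra).
    assert (E2 : rho / 2 ^ n = 2 * (rho / 2 / 2 ^ n)) by (field; lra).
    assert (Hpos : 0 < rho / 2 / 2 ^ n) by (apply Rdiv_lt_0_compat; lra).
    assert (H1 : Cmod (T (S n) - t0)%C <= rho - rho / 2 ^ S n).
    { rewrite HT; replace (T n + d n - t0)%C with ((T n - t0) + d n)%C by ring.
      apply Rle_trans with (1 := Cmod_triangle _ _); lra. }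
    split; [exact H1|].
    apply Hd0.
    replace (v - phi (T (S n)))%C
      with (- (phi (T (S n)) - phi (T n) - RtoC a * (T (S n) - T n)))%C.
    + rewrite Cmod_opp.
      apply Rle_trans with (1 := Hphi (T (S n)) (T n) ltac:(lra) ltac:(lra)).
      replace (T (S n) - T n)%C with (d n) by (rewrite HT; ring).
      replace (rho / 2 / 2 ^ S n) with (rho / 2 / 2 ^ n / 2) by (simpl; field; lra).
      nra.
    + rewrite HT at 2; unfold d; field; exact Ha0. }
assert (Hex : ex_series (K := C_AbsRing) (V := C_CompleteNormedModule) d).
{ apply (ex_series_le (K := C_AbsRing) (V := C_CompleteNormedModule) _
           (fun n => rho / 2 / 2 ^ n)); [|apply ex_series_half].
  intros n; apply Hinv. }
destruct Hex as [l Hl]; change C in (type of l).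
assert (Hball : Cmod (t0 + l - t0)%C <= rho).
{ replace (t0 + l - t0)%C with l by ring.
  replace rho with (2 * (rho / 2)) by field; rewrite <- Series_half.
  apply (Cmod_series_le d); auto; [apply Hinv | apply ex_series_half]. }
exists (t0 + l)%C; split; [exact Hball|].
assert (Hsum : forall n, sum_n d n = (T (S n) - t0)%C).
{ induction n as [|n IH].
  - rewrite sum_O, HT; change (@eq C (d 0%nat) (t0 + d 0%nat - t0)%C); ring.
  - rewrite sum_Sn, IH, (HT (S n)).
    change (@eq C (T (S n) - t0 + d (S n))%C (T (S n) + d (S n) - t0)%C); ring. }
enough (E : (v - phi (t0 + l))%C = RtoC 0).
{ replace (phi (t0 + l)%C) with (v - (v - phi (t0 + l)))%C by ring; rewrite E; ring. }
(* The residual at the limit splits into three pieces, of size at most [a * eps], [a / 2 * eps] and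
   [a * eps]. *)
apply (Cmod_le_by_eps _ (3 * a)); intros eps He.
assert (Hnear : eventually (fun n => Cmod (sum_n d n - l)%C < eps)).
{ apply (Hl (fun y => Cmod (y - l)%C < eps)).
  apply (locally_le_locally_norm (K := C_AbsRing) (V := C_NormedModule)).
  exists (mkposreal eps He); intros y Hy; exact Hy. }
destruct Hnear as [n0 Hn0].
destruct (pow2_arch (rho / 2) eps He) as [n1 Hn1].
set (n := (n0 + n1)%nat).
assert (HA : Cmod (T (S n) - (t0 + l))%C < eps).
{ replace (T (S n) - (t0 + l))%C with (sum_n d n - l)%C by (rewrite Hsum; ring).
  apply Hn0; unfold n; lia. }
assert (HB : Cmod (d (S n)) < eps).
{ apply Rle_lt_trans with (1 := proj2 (Hinv (S n))).
  apply Rle_lt_trans with (2 := Hn1).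
  apply Rmult_le_compat_l; [lra|].
  apply Rinv_le_contravar; [apply two_pow_pos|].
  apply Rle_pow; [lra | unfold n; lia]. }
destruct (Hinv (S n)) as [HTn _].
assert (Hp : 0 < rho / 2 ^ S n) by (apply Rdiv_lt_0_compat; auto using two_pow_pos).
assert (HC := Hphi (T (S n)) (t0 + l)%C ltac:(lra) Hball).
replace (v - phi (t0 + l))%C
  with (RtoC a * d (S n) + (phi (T (S n)) - phi (t0 + l)
          - RtoC a * (T (S n) - (t0 + l))) + RtoC a * (T (S n) - (t0 + l)))%C
  by (unfold d; field; exact Ha0).
apply Rle_trans with (1 := Cmod_triangle _ _).
rewrite Cmod_mult, Cmod_R, (Rabs_pos_eq a) by lra.
assert (HD := Cmod_triangle (RtoC a * d (S n))%C
                (phi (T (S n)) - phi (t0 + l) - RtoC a * (T (S n) - (t0 + l)))%C).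
rewrite Cmod_mult, Cmod_R, (Rabs_pos_eq a) in HD by lra.
nra.
Qed.

Lemma Cpow_lipschitz (q : R) (t t' : C) (n : nat) :
  Cmod t <= q -> Cmod t' <= q ->
  Cmod (Cpow t (S n) - Cpow t' (S n))%C <= INR (S n) * q ^ n * Cmod (t - t')%C.
Proof.
intros Ht Ht'; induction n as [|n IH].
- simpl; rewrite !Cmult_1_r; lra.
- replace (Cpow t (S (S n)) - Cpow t' (S (S n)))%C
    with (t * (Cpow t (S n) - Cpow t' (S n)) + (t - t') * Cpow t' (S n))%C
    by (rewrite !(Cpow_S _ (S n)); ring).
  apply Rle_trans with (1 := Cmod_triangle _ _).
  rewrite !Cmod_mult, Cmod_pow.
  assert (H0 := Cmod_ge_0 t); assert (H1 := Cmod_ge_0 (t - t')%C).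
  assert (H2 : Cmod t' ^ S n <= q ^ S n) by (apply pow_incr; split; auto using Cmod_ge_0).
  rewrite (S_INR (S n)).
  replace ((INR (S n) + 1) * q ^ S n * Cmod (t - t')%C)
    with (q * (INR (S n) * q ^ n * Cmod (t - t')%C) + Cmod (t - t')%C * q ^ S n)
    by (simpl; ring).
  apply Rplus_le_compat; [apply Rmult_le_compat|]; auto using Cmod_ge_0.
  now apply Rmult_le_compat_l.
Qed.

Lemma Cpow_lipschitz_disk (t t' : C) (n : nat) :
  Cmod t <= 1 -> Cmod t' <= 1 ->
  Cmod (Cpow t n - Cpow t' n)%C <= INR n * Cmod (t - t')%C.
Proof.
intros Ht Ht'; destruct n as [|n].
- simpl; replace (1 - 1)%C with (RtoC 0) by ring; rewrite Cmod_0; lra.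
- assert (H := Cpow_lipschitz 1 t t' n Ht Ht'); rewrite pow1 in H; lra.
Qed.

(** Deviation of a power from its linearization at [t0], with the second-derivative bound
    [(n + 1) n q ^ (n - 1)]. The factor [q] on the left avoids the exponent [n - 1], so that [n = 0]
    needs no separate form. *)
Lemma Cpow_second_order (q rho : R) (t t' t0 : C) (n : nat) :
  Cmod t <= q -> Cmod t' <= q -> Cmod t0 <= q ->
  Cmod (t - t0)%C <= rho -> Cmod (t' - t0)%C <= rho ->
  q * Cmod (Cpow t (S n) - Cpow t' (S n)
            - RtoC (INR (S n)) * Cpow t0 n * (t - t'))%C
  <= INR (S n) * INR n * q ^ n * rho * Cmod (t - t')%C.
Proof.
intros Ht Ht' Ht0 Hr Hr'.
assert (Hq : 0 <= q) by (apply Rle_trans with (2 := Ht); apply Cmod_ge_0).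
induction n as [|n IH].
- simpl; replace (t * 1 - t' * 1 - 1 * 1 * (t - t'))%C with (RtoC 0) by ring.
  rewrite Cmod_0; lra.
- set (D := (Cpow t (S n) - Cpow t' (S n) - RtoC (INR (S n)) * Cpow t0 n * (t - t'))%C)
    in *.
  replace (Cpow t (S (S n)) - Cpow t' (S (S n))
           - RtoC (INR (S (S n))) * Cpow t0 (S n) * (t - t'))%C
    with (t * D + (t - t0) * (RtoC (INR (S n)) * Cpow t0 n * (t - t'))
          + (t - t') * (Cpow t' (S n) - Cpow t0 (S n)))%C.
  + assert (H1 := Cpow_lipschitz q t' t0 n Ht' Ht0).
    set (y := (Cpow t' (S n) - Cpow t0 (S n))%C) in *.
    assert (H2 : Cmod t0 ^ n <= q ^ n) by (apply pow_incr; split; auto using Cmod_ge_0).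
    set (P := ((t - t0) * (RtoC (INR (S n)) * Cpow t0 n * (t - t')))%C).
    assert (H3 := Cmod_triangle (t * D + P)%C ((t - t') * y)%C).
    assert (H4 := Cmod_triangle (t * D)%C P).
    rewrite (Cmod_mult (t - t')) in H3; rewrite (Cmod_mult t) in H4.
    assert (HP : Cmod P = Cmod (t - t0)%C * (INR (S n) * Cmod t0 ^ n * Cmod (t - t')%C)).
    { unfold P; rewrite !Cmod_mult, Cmod_R, Cmod_pow, Rabs_pos_eq; auto using pos_INR. }
    assert (Hd := Cmod_ge_0 (t - t')%C); assert (HD := Cmod_ge_0 D).
    assert (Hr1 := Cmod_ge_0 (t - t0)%C); assert (Hr2 := Cmod_ge_0 (t' - t0)%C).
    assert (Hn := pos_INR (S n)); assert (Hqn : 0 <= q ^ n) by now apply pow_le.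
    assert (Ht0n : 0 <= Cmod t0 ^ n) by (apply pow_le, Cmod_ge_0).
    set (m := INR (S n)) in *; set (dl := Cmod (t - t')%C) in *.
    set (Q := q ^ n) in *; set (r1 := Cmod (t - t0)%C) in *.
    set (r2 := Cmod (t' - t0)%C) in *; set (tn := Cmod t0 ^ n) in *.
    assert (HA : Cmod t * Cmod D <= q * Cmod D) by (apply Rmult_le_compat_r; auto).
    assert (HB : r1 * (m * tn * dl) <= rho * (m * Q * dl)).
    { apply Rmult_le_compat; auto.
      - repeat apply Rmult_le_pos; auto.
      - apply Rmult_le_compat_r; auto; now apply Rmult_le_compat_l. }
    assert (HC : dl * Cmod y <= dl * (m * Q * rho)).
    { apply Rmult_le_compat_l; auto; apply Rle_trans with (1 := H1).
      apply Rmult_le_compat_l; auto; now apply Rmult_le_pos. }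
    apply Rle_trans with (q * (q * Cmod D + rho * (m * Q * dl) + dl * (m * Q * rho))).
    { apply Rmult_le_compat_l; auto; lra. }
    rewrite (S_INR (S n)); fold m.
    apply Rmult_le_compat_l with (r := q) in IH; auto.
    replace (INR n) with (m - 1) in IH by (unfold m; rewrite S_INR; ring).
    simpl (q ^ S n); fold Q; lra.
  + unfold D; rewrite !(Cpow_S _ (S n)), (Cpow_S t0 n), (S_INR (S n)), RtoC_plus; ring.
Qed.

Lemma INR_pow2 (n : nat) : INR (2 ^ n) = 2 ^ n.
Proof. now rewrite pow_INR. Qed.

Lemma Cmod_pow_lt_1 (z : C) (n : nat) : Cmod z < 1 -> Cmod (Cpow z (S n)) < 1.
Proof.
intros Hz; rewrite Cmod_pow.
apply pow_lt_1_compat; [split; auto using Cmod_ge_0 | lia].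
Qed.

Lemma Cmod_pow2_lt_1 (z : C) (n : nat) : Cmod z < 1 -> Cmod (Cpow z (2 ^ n)) < 1.
Proof.
intros Hz; assert (H := Nat.pow_nonzero 2 n ltac:(lia)).
destruct (2 ^ n)%nat; [lia | now apply Cmod_pow_lt_1].
Qed.

(** The difference is the polynomial formed by the first [K] terms, whose Lipschitz constants
    [2 ^ k] on the unit disk sum to less than [2 ^ K]. *)
Lemma fredholm_head_lipschitz (z z' : C) (K : nat) :
  Cmod z < 1 -> Cmod z' < 1 ->
  Cmod ((fredholm z - fredholm (Cpow z (2 ^ K)))
        - (fredholm z' - fredholm (Cpow z' (2 ^ K))))%C <= 2 ^ K * Cmod (z - z')%C.
Proof.
intros Hz Hz'; induction K as [|K IH].
- change (2 ^ 0)%nat with 1%nat; rewrite !Cpow_1_r.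
  replace (_ - _)%C with (RtoC 0) by ring; rewrite Cmod_0; simpl.
  assert (H := Cmod_ge_0 (z - z')%C); lra.
- assert (Hstep : forall w, Cmod w < 1 ->
            (fredholm w - fredholm (Cpow w (2 ^ S K))
             = (fredholm w - fredholm (Cpow w (2 ^ K))) + Cpow w (2 ^ K))%C).
  { intros w Hw.
    rewrite (fredholm_step (Cpow w (2 ^ K))) by now apply Cmod_pow2_lt_1.
    replace (2 ^ S K)%nat with (2 ^ K + 2 ^ K)%nat by (simpl; lia).
    rewrite Cpow_add_r; ring. }
  rewrite !Hstep by assumption.
  set (A := (fredholm z - _)%C) in *; set (B := (fredholm z' - _)%C) in *.
  replace (A + Cpow z (2 ^ K) - (B + Cpow z' (2 ^ K)))%C
    with ((A - B) + (Cpow z (2 ^ K) - Cpow z' (2 ^ K)))%C by ring.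
  apply Rle_trans with (1 := Cmod_triangle _ _).
  assert (H := Cpow_lipschitz_disk z z' (2 ^ K) ltac:(lra) ltac:(lra)).
  rewrite INR_pow2 in H; simpl; lra.
Qed.

Lemma exp_opp_pow (s : R) (N n : nat) :
  N <> 0%nat -> exp (- (s / INR N)) ^ (N * n) = exp (- (s * INR n)).
Proof.
intros HN; assert (H : INR N <> 0) by now apply not_0_INR.
rewrite <- Rpower_pow by apply exp_pos; unfold Rpower; rewrite ln_exp, mult_INR.
f_equal; field; exact H.
Qed.

Lemma exp_opp_le_half (x : R) : 0 <= x <= 1 -> exp (- x) <= 1 - x / 2.
Proof.
intros Hx.
assert (H1 := exp_ineq1_le x); assert (H2 : exp x * exp (- x) = 1).
{ rewrite <- exp_plus, Rplus_opp_r, exp_0; auto. }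
assert (H3 := exp_pos (- x)); nra.
Qed.

(** This is [w * f' w] at [w = exp (- s)]; hence [t |-> f (t ^ (2 ^ K))] has derivative
    [2 ^ K / t0 * slope s] at [t0 = exp (- s / 2 ^ K)]. *)
Definition slope (s : R) : R := Series (fun i => exp (- (s * 2 ^ i)) * (2 ^ i) ^ 1).

Lemma slope_ge (s : R) : 0 < s <= 1 / 8 -> 4 <= slope s.
Proof.
intros Hs; unfold slope.
assert (Hex := ex_series_exp_pow s 1 ltac:(lra)).
(* Three terms suffice: they are at least [(1 - s) + 2 * (1 - 2 * s) + 4 * (1 - 4 * s) = 7 - 21 *
   s], which exceeds 4 for [s <= 1 / 8]. *)
rewrite Series_incr_1 by exact Hex.
apply ex_series_incr_1 in Hex; rewrite Series_incr_1 by exact Hex.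
apply ex_series_incr_1 in Hex; rewrite Series_incr_1 by exact Hex.
apply ex_series_incr_1 in Hex.
match goal with |- _ <= _ + (_ + (_ + ?x)) => assert (Htail : 0 <= x) end.
{ rewrite <- (Ropp_involutive (Series _)), <- Series_opp.
  apply Ropp_0_ge_le_contravar, Rle_ge, Series_le_0.
  - intros k; match goal with |- - ?x <= 0 => enough (0 <= x) by lra end.
    apply Rmult_le_pos; [left; apply exp_pos | apply pow_le, pow_le; lra].
  - now apply (ex_series_opp (V := R_NormedModule)). }
assert (H0 := exp_ge_1_minus (s * 2 ^ 0)).
assert (H1 := exp_ge_1_minus (s * 2 ^ 1)).
assert (H2 := exp_ge_1_minus (s * 2 ^ 2)).
simpl in *; lra.
Qed.

Definition curvature : R := Series (fun i => exp (- (1 / 128 * 2 ^ i)) * (2 ^ i) ^ 2).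

(** Sums [Cpow_second_order] over the exponents [2 ^ K * 2 ^ i]. On the disk all moduli are at most
    [q], whose powers at these exponents are [exp (- 2 ^ i / 128)]; so the error is governed by
    [curvature], independently of [K] and [s]. *)
Lemma fredholm_tail_second_order (K : nat) (s kap : R) (t t' : C) :
  1 / 32 <= s <= 1 / 8 -> kap <= 1 / 128 ->
  let t0 := exp (- (s / 2 ^ K)) in
  Cmod (t - RtoC t0)%C <= kap / 2 ^ K -> Cmod (t' - RtoC t0)%C <= kap / 2 ^ K ->
  Cmod t < 1 /\ Cmod t' < 1 /\
  Cmod (fredholm (Cpow t (2 ^ K)) - fredholm (Cpow t' (2 ^ K))
        - RtoC (2 ^ K / t0 * slope s) * (t - t'))%C
  <= 4 * kap * curvature * 2 ^ K * Cmod (t - t')%C.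
Proof.
intros Hs Hk t0 Ht Ht'.
set (q := exp (- (1 / 128 / 2 ^ K))).
assert (HK : 1 <= 2 ^ K) by (apply pow_R1_Rle; lra).
assert (HKi : 0 < / 2 ^ K <= 1).
{ split; [apply Rinv_0_lt_compat; lra|].
  rewrite <- Rinv_1; apply Rinv_le_contravar; lra. }
assert (HsK : 1 / 32 * / 2 ^ K <= s / 2 ^ K <= 1 / 8 * / 2 ^ K).
{ split; apply Rmult_le_compat_r; lra. }
assert (HkK : kap / 2 ^ K <= 1 / 128 * / 2 ^ K).
{ apply Rmult_le_compat_r; lra. }
assert (Hq1 := exp_ge_1_minus (1 / 128 / 2 ^ K)); fold q in Hq1.
change (1 / 128 / 2 ^ K) with (1 / 128 * / 2 ^ K) in Hq1.
assert (Hqlt : q < 1).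
{ unfold q; apply Rlt_le_trans with (exp 0); [apply exp_increasing | rewrite exp_0; lra].
  change (1 / 128 / 2 ^ K) with (1 / 128 * / 2 ^ K); lra. }
assert (Ht0 := exp_opp_le_half (s / 2 ^ K) ltac:(lra)); fold t0 in Ht0.
assert (Ht0' := exp_ge_1_minus (s / 2 ^ K)); fold t0 in Ht0'.
(* In units of [/ 2 ^ K], [t0] is at least 1/64 below 1 and the radius is at most 1/128, so the disk
   stays 1/128 below 1. *)
assert (Hball : forall w, Cmod (w - RtoC t0)%C <= kap / 2 ^ K -> Cmod w <= q).
{ intros w Hw; replace w with ((w - RtoC t0) + RtoC t0)%C by ring.
  apply Rle_trans with (1 := Cmod_triangle _ _).
  rewrite Cmod_R, Rabs_pos_eq by (left; apply exp_pos).
  lra. }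
assert (Htq := Hball t Ht); assert (Htq' := Hball t' Ht').
assert (Ht0q : Cmod (RtoC t0) <= q).
{ rewrite Cmod_R, Rabs_pos_eq by (left; apply exp_pos); lra. }
split; [lra|]; split; [lra|].
set (dl := (t - t')%C).
set (a := fun i => 2 ^ K / t0 * (exp (- (s * 2 ^ i)) * (2 ^ i) ^ 1)).
assert (Ha : is_series a (2 ^ K / t0 * slope s)).
{ apply (is_series_scal (K := R_AbsRing) (V := R_NormedModule)).
  apply Series_correct, ex_series_exp_pow; lra. }
apply is_series_RtoC in Ha.
assert (HS := fredholm_correct _ (Cmod_pow2_lt_1 t K ltac:(lra))).
assert (HS' := fredholm_correct _ (Cmod_pow2_lt_1 t' K ltac:(lra))).
assert (HS2 := is_series_minus (K := C_AbsRing) (V := C_NormedModule) _ _ _ _ HS HS').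
apply (is_series_scal (K := C_AbsRing) (V := C_NormedModule) dl) in Ha.
assert (HS3 := is_series_minus (K := C_AbsRing) (V := C_NormedModule) _ _ _ _ HS2 Ha).
match type of HS3 with is_series ?u ?l =>
  apply Rle_trans with (Series (fun i => 4 * kap * 2 ^ K * Cmod dl
                                 * (exp (- (1 / 128 * 2 ^ i)) * (2 ^ i) ^ 2)));
  [replace (_ - _ - _)%C with (l : C); [apply (Cmod_series_le u) with (1 := HS3)|]|]
end.
- intros i.
  change (Cmod (Cpow (Cpow t (2 ^ K)) (2 ^ i) - Cpow (Cpow t' (2 ^ K)) (2 ^ i)
                - dl * RtoC (a i))%C
          <= 4 * kap * 2 ^ K * Cmod dl * (exp (- (1 / 128 * 2 ^ i)) * (2 ^ i) ^ 2)).
  rewrite <- !Cpow_mult_r.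
  assert (Hi : 1 <= 2 ^ i) by (apply pow_R1_Rle; lra).
  assert (HN : (2 ^ K <> 0)%nat) by (apply Nat.pow_nonzero; lia).
  assert (Ht0m := exp_opp_pow s (2 ^ K) (2 ^ i) HN).
  assert (Hqm := exp_opp_pow (1 / 128) (2 ^ K) (2 ^ i) HN).
  assert (Hm : INR (2 ^ K * 2 ^ i) = 2 ^ K * 2 ^ i) by (rewrite mult_INR, !INR_pow2; auto).
  rewrite !INR_pow2 in Ht0m, Hqm; fold t0 in Ht0m; fold q in Hqm.
  destruct (2 ^ K * 2 ^ i)%nat as [|n]; [simpl in Hm; nra|].
  replace (dl * RtoC (a i))%C
    with (RtoC (INR (S n)) * Cpow (RtoC t0) n * (t - t'))%C.
  + assert (H := Cpow_second_order q (kap / 2 ^ K) t t' (RtoC t0) n Htq Htq' Ht0q Ht Ht').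
    set (D := Cmod (_ - _ - _)%C) in *.
    assert (HD : 0 <= D) by apply Cmod_ge_0.
    fold dl in H; assert (Hdl := Cmod_ge_0 dl).
    assert (Hn := S_INR n); rewrite Hm in H, Hn.
    assert (Hkap : 0 <= kap / 2 ^ K) by (apply Rle_trans with (2 := Ht), Cmod_ge_0).
    assert (Hqn : 0 <= q ^ n) by (apply pow_le; lra).
    rewrite <- Hqm; simpl (q ^ S n).
    set (m := 2 ^ K * 2 ^ i) in *.
    assert (Hn0 := pos_INR n).
    (* The factor 4 comes from dividing twice by [q]: once for the left side of [Cpow_second_order],
       once to pass from [q ^ n] to [q ^ S n]. *)
    assert (Hq2 : 1 / 2 <= q) by lra.
    replace (4 * kap * 2 ^ K * Cmod dl * (q * q ^ n * (2 ^ i) ^ 2))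
      with (4 * q * (m * m * q ^ n * (kap / 2 ^ K) * Cmod dl))
      by (unfold m; field; lra).
    set (X := q ^ n * (kap / 2 ^ K) * Cmod dl) in *.
    assert (HX : 0 <= X) by (unfold X; apply Rmult_le_pos; auto; apply Rmult_le_pos; auto).
    replace (m * m * q ^ n * (kap / 2 ^ K) * Cmod dl) with (m * m * X) by (unfold X; ring).
    replace (m * INR n * q ^ n * (kap / 2 ^ K) * Cmod dl) with (m * INR n * X) in H
      by (unfold X; ring).
    assert (Hm0 : 0 <= m) by lra.
    assert (HmX : m * INR n * X <= m * m * X).
    { apply Rmult_le_compat_r; auto; apply Rmult_le_compat_l; lra. }
    set (Z := m * m * X) in *.
    assert (HZ : 0 <= Z) by (unfold Z; apply Rmult_le_pos; auto; apply Rmult_le_pos; auto).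
    assert (HD1 : 1 / 2 * D <= q * D) by (apply Rmult_le_compat_r; auto).
    assert (HZ1 : 1 / 2 * Z <= q * Z) by (apply Rmult_le_compat_r; auto).
    lra.
  + rewrite <- RtoC_pow, <- RtoC_mult, (Cmult_comm dl); f_equal; f_equal.
    unfold a; rewrite <- Ht0m, Hm; simpl; field.
    apply Rgt_not_eq, exp_pos.
- apply (ex_series_scal (K := R_AbsRing) (V := R_NormedModule)), ex_series_exp_pow; lra.
- change (fredholm (Cpow t (2 ^ K)) - fredholm (Cpow t' (2 ^ K))
          - dl * RtoC (2 ^ K / t0 * slope s)
          = fredholm (Cpow t (2 ^ K)) - fredholm (Cpow t' (2 ^ K))
            - RtoC (2 ^ K / t0 * slope s) * dl)%C; ring.
- rewrite Series_scal_l; fold curvature; apply Req_le; ring.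
Qed.

(** The rotation [zeta] does not affect the tail [f (t ^ (2 ^ K))], which is affine of slope
    [a >= 4 * 2 ^ K] up to a Lipschitz error [2 ^ K]; the head adds another [2 ^ K]. The total is at
    most [a / 2], as [newton_solution] demands, and [a / 2 * (kap / 2 ^ K)] is at least
    [2 * kap]. *)
Lemma fredholm_uniformly_open :
  exists kap, 0 < kap <= 1 / 128 /\
  forall (K : nat) (s : R) (zeta v : C),
  1 / 32 <= s <= 1 / 8 -> Cmod zeta = 1 -> Cpow zeta (2 ^ K) = RtoC 1 ->
  Cmod (v - fredholm (zeta * RtoC (exp (- (s / 2 ^ K)))))%C <= 2 * kap ->
  exists t : C, Cmod (t - RtoC (exp (- (s / 2 ^ K))))%C <= kap / 2 ^ K /\
                Cmod t < 1 /\ fredholm (zeta * t)%C = v.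
Proof.
set (A := Rmax 1 curvature).
assert (HA : 1 <= A) by apply Rmax_l; assert (HA' : curvature <= A) by apply Rmax_r.
(* Chosen so that [kap <= 1 / 128] and [4 * kap * curvature <= 1] both hold. *)
exists (1 / (128 * A)).
assert (HkA : 0 < 1 / (128 * A)) by (apply Rdiv_lt_0_compat; lra).
set (kap := 1 / (128 * A)) in *.
assert (HkA' : kap * A = 1 / 128) by (unfold kap; field; lra).
assert (Hk : kap <= 1 / 128) by nra.
split; [lra|].
intros K s zeta v Hs Hz HzK Hv.
set (t0 := exp (- (s / 2 ^ K))) in *.
assert (HK : 1 <= 2 ^ K) by (apply pow_R1_Rle; lra).
set (a := 2 ^ K / t0 * slope s).
assert (Ha : 4 * 2 ^ K <= a).
{ unfold a.
  assert (H := slope_ge s ltac:(lra)).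
  assert (Ht0 := exp_opp_le_1 (s / 2 ^ K) ltac:(apply Rdiv_le_0_compat; lra)).
  fold t0 in Ht0.
  assert (1 <= / t0) by (rewrite <- Rinv_1; apply Rinv_le_contravar; lra).
  assert (2 ^ K <= 2 ^ K / t0) by (unfold Rdiv; nra).
  apply Rle_trans with (2 ^ K * slope s); [nra | apply Rmult_le_compat_r; lra]. }
destruct (newton_solution (fun t => fredholm (zeta * t)%C) (RtoC t0) v a (kap / 2 ^ K))
  as (t & Ht & Hft).
- lra.
- apply Rdiv_lt_0_compat; lra.
- intros t t' Ht Ht'.
  destruct (fredholm_tail_second_order K s kap t t' Hs Hk Ht Ht') as (H1 & H1' & H2).
  fold t0 in H2; fold a in H2.
  assert (Hzt : forall w, Cpow (zeta * w) (2 ^ K) = Cpow w (2 ^ K)).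
  { intros w; rewrite Cpow_mult_l, HzK; ring. }
  assert (H3 := fredholm_head_lipschitz (zeta * t)%C (zeta * t')%C K
                  ltac:(rewrite Cmod_mult, Hz; lra) ltac:(rewrite Cmod_mult, Hz; lra)).
  rewrite !Hzt in H3.
  replace (zeta * t - zeta * t')%C with (zeta * (t - t'))%C in H3 by ring.
  rewrite Cmod_mult, Hz, Rmult_1_l in H3.
  set (f1 := fredholm (zeta * t)%C) in *; set (f2 := fredholm (zeta * t')%C) in *.
  set (g1 := fredholm (Cpow t (2 ^ K))) in *; set (g2 := fredholm (Cpow t' (2 ^ K))) in *.
  replace (f1 - f2 - RtoC a * (t - t'))%C
    with ((f1 - g1 - (f2 - g2)) + (g1 - g2 - RtoC a * (t - t')))%C by ring.
  apply Rle_trans with (1 := Cmod_triangle _ _).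
  assert (H4 : 4 * kap * curvature <= 1) by nra.
  assert (H5 := Cmod_ge_0 (t - t')%C).
  assert (H6 : 4 * kap * curvature * 2 ^ K * Cmod (t - t')%C <= 1 * 2 ^ K * Cmod (t - t')%C).
  { repeat apply Rmult_le_compat_r; lra. }
  assert (H7 : 2 * 2 ^ K * Cmod (t - t')%C <= a / 2 * Cmod (t - t')%C).
  { apply Rmult_le_compat_r; lra. }
  lra.
- apply Rle_trans with (1 := Hv).
  assert (H : kap / 2 ^ K * 2 ^ K = kap) by (field; lra).
  assert (0 < kap / 2 ^ K) by (apply Rdiv_lt_0_compat; lra).
  nra.
- exists t; split; [exact Ht|]; split; [|exact Hft].
  apply (fredholm_tail_second_order K s kap t t Hs Hk Ht Ht).
Qed.

(** * Attaining a value near 1, infinitely often *)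

Lemma Cmod_le_abs_sum (x y : R) : Cmod (x, y) <= Rabs x + Rabs y.
Proof.
assert (H := Cmod_fst_snd x y); assert (H0 := Cmod_ge_0 (x, y)).
assert (Hx := Rabs_pos x); assert (Hy := Rabs_pos y).
rewrite <- (pow2_abs x), <- (pow2_abs y) in H; nra.
Qed.

Lemma Cmod_pt_minus_1 (a x : R) :
  0 <= x -> Cmod (pt a x - RtoC 1)%C <= x + 2 * Rabs a.
Proof.
intros Hx.
change (pt a x - RtoC 1)%C with (exp (- x) * cos a + - 1, exp (- x) * sin a + - 0).
apply Rle_trans with (1 := Cmod_le_abs_sum _ _).
assert (H1 := Rmult_exp_error (cos a) x (Rabs_cos_le_1 a) Hx).
assert (H2 := proj1 angular_cos a); simpl in H2.
assert (H3 := Rabs_sin_le a).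
assert (He := exp_opp_le_1 x Hx).
assert (H4 : Rabs (exp (- x) * cos a + - 1) <= x + Rabs a).
{ replace (_ + - 1) with ((exp (- x) * cos a - cos a) + (cos a - 1)) by ring.
  apply Rle_trans with (1 := Rabs_triang _ _); lra. }
assert (H5 : Rabs (exp (- x) * sin a + - 0) <= Rabs a).
{ rewrite Ropp_0, Rplus_0_r, Rabs_mult, (Rabs_pos_eq (exp _)) by lra.
  assert (H6 := Rabs_pos (sin a)); nra. }
lra.
Qed.

Lemma fredholm_value_near_1 (r : R) (v : C) :
  0 < r -> exists z : C, Cmod z < 1 /\ Cmod (z - RtoC 1)%C < r /\ fredholm z = v.
Proof.
intros Hr.
destruct fredholm_uniformly_open as (kap & Hkap & Hopen).
assert (HP := PI_RGT_0).
set (e := Rmin kap r).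
assert (He : 0 < e) by (apply Rmin_pos; lra).
assert (Hek : e <= kap) by apply Rmin_l; assert (Her : e <= r) by apply Rmin_r.
destruct (pow2_arch 1 (e / 8) ltac:(lra)) as [L HL].
destruct (pow2_arch (2 * PI) (e / 8) ltac:(lra)) as [k Hk].
assert (HLp : 1 <= 2 ^ L) by (apply pow_R1_Rle; lra).
assert (HLi : 0 < 1 / 2 ^ L) by (apply Rdiv_lt_0_compat; lra).
(* [x] will range over [[x1 / 4, x1]]: it is small, yet [s = x * 2 ^ L] lies in [[1 / 32, 1 / 8]],
   the window of the openness lemma. *)
set (x1 := 1 / 8 * (1 / 2 ^ L)).
assert (Hx1 : 0 < x1 <= 1 / 8) by (unfold x1; lra).
(* This bound forces [J >= B + k] below, which makes the angle [2 * PI * m / 2 ^ J] small. *)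
set (N := Re v - Fsum (x1 / 4) - INR k).
destruct (steerable_all (Im v) (e / 8) N ltac:(lra)) as (m & B & HB & HY & HN).
(* [J] is the least integer above [c]. From [J > c] follows [g (x1 / 4) >= Re v]; from [J <= c + 1]
   and [Fsum_quarter] follows [g x1 <= Re v], as [1 + 1 / 4 + 1 / 4 = 3 / 2]. *)
set (c := Re v + 1 / 4 - Fsum (x1 / 4) - Rsum (IZR m)).
assert (HcB : INR (B + k) <= c) by (rewrite plus_INR; unfold c, N in *; lra).
destruct (archimed c) as [Hc1 Hc2].
assert (Hup : (0 <= up c)%Z).
{ apply le_IZR; assert (H := pos_INR (B + k)); lra. }
set (J := Z.to_nat (up c)).
assert (HJ : INR J = IZR (up c)) by (unfold J; rewrite INR_IZR_INZ, Z2Nat.id; auto).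
assert (HJB : (B + k <= J)%nat) by (apply INR_le; lra).
assert (HJp := two_pow_pos J).
assert (Hang : 2 * PI * Rabs (IZR m / 2 ^ J) < e / 8).
{ apply Rle_lt_trans with (2 := Hk).
  apply Rmult_le_compat_l; [lra|].
  rewrite Rabs_div, (Rabs_pos_eq (2 ^ J)) by lra.
  assert (Hkp := two_pow_pos k).
  assert (HBk : 2 ^ B * 2 ^ k <= 2 ^ J) by (rewrite <- pow_add; apply Rle_pow; [lra | auto]).
  apply Rmult_le_reg_r with (2 ^ J * 2 ^ k); [now apply Rmult_lt_0_compat|].
  replace (Rabs (IZR m) / 2 ^ J * (2 ^ J * 2 ^ k)) with (Rabs (IZR m) * 2 ^ k)
    by (field; lra).
  replace (/ 2 ^ k * (2 ^ J * 2 ^ k)) with (2 ^ J) by (field; lra).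
  nra. }
assert (HYJ := dsum_bound sin (IZR m / 2 ^ J) angular_sin).
assert (HRJ := dsum_bound _ (IZR m / 2 ^ J) angular_cos).
set (g := fun x => Re (fredholm (orbit_pt m x J))).
assert (Hge : forall x, 0 < x <= x1 -> Rabs (g x - (INR J + Fsum x + Rsum (IZR m))) <= 1 / 4).
{ intros x Hx; assert (H := Re_fredholm_orbit m x J ltac:(lra)); fold (g x) in H.
  assert (0 < x / 2 ^ J) by (apply Rdiv_lt_0_compat; lra).
  apply Rabs_le_between in H; apply Rabs_le_between in HRJ.
  apply Rabs_le_between; lra. }
destruct (Re_fredholm_orbit_lipschitz m (x1 / 4) J ltac:(lra)) as (A & HA & HgA).
destruct (lipschitz_IVT g A (x1 / 4) x1 (Re v) ltac:(lra) HA HgA) as (x & Hx & Hgx).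
{ assert (H1 := Hge x1 ltac:(lra)); assert (H2 := Hge (x1 / 4) ltac:(lra)).
  assert (H3 := Fsum_quarter x1 Hx1).
  apply Rabs_le_between in H1; apply Rabs_le_between in H2; unfold c in *; lra. }
(* The point [z_J] is left unchanged; only its radius is rewritten with [K] in place of [J]. As
   [K >= J], [zeta] is still a root of unity of order dividing [2 ^ K]. *)
set (s := x * 2 ^ L); set (K := (J + L)%nat).
assert (HsK : s / 2 ^ K = x / 2 ^ J) by (unfold s, K; rewrite pow_add; field; lra).
set (zeta := pt (2 * PI * IZR m / 2 ^ J) 0).
assert (Hzt0 : (zeta * RtoC (exp (- (s / 2 ^ K))))%C = orbit_pt m x J).
{ rewrite HsK, <- (pt_2PI 0); unfold zeta; rewrite pt_mult; unfold orbit_pt.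
  f_equal; ring. }
assert (Hzeta : Cmod zeta = 1) by (unfold zeta; rewrite Cmod_pt, Ropp_0; apply exp_0).
destruct (Hopen K s zeta v) as (t & Ht & Ht1 & Hft).
- unfold s; assert (Hx1L : x1 * 2 ^ L = 1 / 8) by (unfold x1; field; lra); nra.
- exact Hzeta.
- unfold zeta; rewrite pt_pow, Rmult_0_r, INR_pow2.
  replace (2 ^ K * (2 * PI * IZR m / 2 ^ J)) with (2 * IZR (2 ^ Z.of_nat L * m) * PI).
  + rewrite pt_2PI, Ropp_0, exp_0; auto.
  + rewrite mult_IZR, <- pow_IZR; unfold K; rewrite pow_add.
    change (IZR 2) with 2; field; lra.
- rewrite Hzt0.
  assert (H := Im_fredholm_orbit m x J ltac:(lra)); fold (g x) in H.
  assert (0 < x / 2 ^ J) by (apply Rdiv_lt_0_compat; lra).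
  unfold g in Hgx; set (w := fredholm (orbit_pt m x J)) in *.
  change (v - w)%C with (Re v + - Re w, Im v + - Im w).
  apply Rle_trans with (1 := Cmod_le_abs_sum _ _).
  (* The real part is exact. The imaginary error is at most [x] plus [e / 8] from [Ysum] at
     [m / 2 ^ J] plus [e / 8] from steering, well within [2 * kap]. *)
  rewrite Hgx, Rplus_opp_r, Rabs_R0, Rplus_0_l.
  apply Rabs_le_between in H; apply Rabs_le_between in HYJ.
  apply Rabs_lt_between in HY; unfold x1 in *.
  apply Rabs_le_between; lra.
- exists (zeta * t)%C; split; [|split; [|exact Hft]].
  + rewrite Cmod_mult, Hzeta; lra.
  + set (t0 := RtoC (exp (- (s / 2 ^ K)))) in *.
    replace (zeta * t - 1)%C with (zeta * (t - t0) + (zeta * t0 - 1))%C by ring.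
    apply Rle_lt_trans with (1 := Cmod_triangle _ _).
    rewrite Cmod_mult, Hzeta, Rmult_1_l, Hzt0.
    assert (Hxp : 0 < x / 2 ^ J) by (apply Rdiv_lt_0_compat; lra).
    assert (HJ1 : 1 <= 2 ^ J) by (apply pow_R1_Rle; lra).
    assert (Hxp' : x / 2 ^ J <= x).
    { apply Rmult_le_reg_r with (2 ^ J); auto.
      unfold Rdiv; rewrite Rmult_assoc, Rinv_l by lra; nra. }
    assert (H := Cmod_pt_minus_1 (2 * PI * IZR m / 2 ^ J) (x / 2 ^ J) ltac:(lra)).
    fold (orbit_pt m x J) in H.
    replace (2 * PI * IZR m / 2 ^ J) with (2 * PI * (IZR m / 2 ^ J)) in H
      by (unfold Rdiv; ring).
    rewrite Rabs_mult, (Rabs_pos_eq (2 * PI)) in H by lra.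
    assert (Hkap' : kap / 2 ^ K <= 1 / 2 ^ L).
    { unfold K; rewrite pow_add.
      apply Rmult_le_reg_r with (2 ^ J * 2 ^ L); [nra|].
      replace (kap / (2 ^ J * 2 ^ L) * (2 ^ J * 2 ^ L)) with kap by (field; lra).
      replace (1 / 2 ^ L * (2 ^ J * 2 ^ L)) with (2 ^ J) by (field; lra); lra. }
    unfold x1 in *; lra.
Qed.

(** Turns existence into infinitude: if the solutions were finite in number, they would avoid a
    small punctured disk about 1, whereas [fredholm_value_near_1] finds one there. *)
Lemma Finite_isolated (X : Ensemble C) (c : C) :
  Finite_sets.Finite C X ->
  exists r, 0 < r /\ forall z, In C X z -> z <> c -> r <= Cmod (z - c)%C.
Proof.
intros HX; induction HX as [|X _ (r & Hr & IH) z0 _].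
- exists 1; split; [lra|]; intros z [].
- destruct (Ceq_dec z0 c) as [->|Hz0].
  + exists r; split; auto.
    intros z [z' Hz|z' Hz] Hzc; [auto | destruct Hz; contradiction].
  + exists (Rmin r (Cmod (z0 - c)%C)); split.
    * apply Rmin_pos; auto; apply Cmod_gt_0; intros E; apply Hz0.
      replace z0 with ((z0 - c) + c)%C by ring; rewrite E; ring.
    * intros z [z' Hz|z' Hz] Hzc.
      -- apply Rle_trans with (1 := Rmin_l _ _); auto.
      -- destruct Hz; apply Rmin_r.
Qed.

Open Scope C_scope.

Theorem theorem1p4 (r : R) (hr : (0 < r)%R) (v : C) :
  ~ Finite_sets.Finite C
      (fun z : C => In C (Intersection C unit_disk (open_disk 1 r)) z /\
                    fredholm z = v).
Proof.
intros Hfin.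
destruct (Finite_isolated _ 1 Hfin) as (r' & Hr' & Hiso).
destruct (fredholm_value_near_1 (Rmin r r') v) as (z & Hz & Hz1 & Hf).
{ now apply Rmin_pos. }
assert (H1 := Rmin_l r r'); assert (H2 := Rmin_r r r').
apply (Rlt_irrefl r'), Rle_lt_trans with (Cmod (z - 1)); [|lra].
apply Hiso.
- split; [split; unfold In, unit_disk, open_disk; lra | exact Hf].
- intros ->; rewrite Cmod_1 in Hz; lra.
Qed.
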